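(* Let $n\geq 2$ be an integer, let $\hat{\omega}\in[n,+\infty]$ and let \[\hat{\lambda}\in \left[ \frac{\hat{\omega}-1}{(n-1)\hat{\omega}} ,\ \frac{\hat{\omega}-n+1}{\hat{\omega}} \right],\] where the interval for $\hat{\lambda}$ is understood to be $\left[\frac{1}{n-1},1\right]$ when $\hat{\omega}=+\infty$. Then there exist uncountably many $n$-tuples of real numbers $\boldsymbol{\theta}=(\theta_1,\ldots,\theta_n)$, with $1,\theta_1,\ldots,\theta_n$ linearly independent over $\mathbb{Q}$, such that $\hat{\omega}_{n-1}(\boldsymbol{\theta})=\hat{\omega}$ and $\hat{\omega}_0(\boldsymbol{\theta})=\hat{\lambda}$.
   Context: Let $\boldsymbol{\theta}=(\theta_1,\ldots,\theta_n)\in\mathbb{R}^n$ with $1,\theta_1,\ldots,\theta_n$ linearly independent over $\mathbb{Q}$. For a rational affine subspace $L\subset\mathbb{R}^n$ (an affine subspace defined over $\mathbb{Q}$), its height $H(L)$ is the height in the sense of Schmidt: identifying $L$ with the rational linear subspace $\tilde L$ of $\mathbb{R}^{n+1}$ spanned by the vectors $(1,x)$, $x\in L$, $H(L)$ is the covolume of the lattice $\tilde L\cap\mathbb{Z}^{n+1}$ in $\tilde L$ (equivalently the Euclidean norm of $x_1\wedge\cdots\wedge x_{d+1}$ for any basis $x_1,\ldots,x_{d+1}$ of that lattice). Let $d(\boldsymbol{\theta},L)=\min_{P\in L}\|\boldsymbol{\theta}-P\|$ be the distance from $\boldsymbol{\theta}$ to $L$. For an integer $0\leq d\leq n-1$,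 the uniform exponent $\hat{\omega}_d(\boldsymbol{\theta})$ is the supremum of the real numbers $\omega$ such that for every sufficiently large real number $H$ there exists a rational affine subspace $L\subset\mathbb{R}^n$ with $\dim L=d$, $H(L)\leq H$ and $H(L)\,d(\boldsymbol{\theta},L)\leq H^{-\omega}$. (So $\hat{\omega}_{n-1}$ is the classical uniform exponent for linear forms and $\hat{\omega}_0$ the classical uniform exponent of simultaneous approximation.) *)

(* Defs.v *)
From HB Require Import structures.
From mathcomp Require Import all_boot all_order all_algebra.
From mathcomp Require Import all_classical all_reals all_analysis.

Set Implicit Arguments.
Unset Strict Implicit.
Unset Printing Implicit Defensive.

Import Order.TTheory GRing.Theory Num.Theory.
Import numFieldNormedType.Exports.

Local Open Scope classical_set_scope.
Local Open Scope ring_scope.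

(* The library norm on 'rV[R]_n is the sup norm; the distances below are
   Euclidean. *)
Definition enorm (R : realType) (n : nat) (x : 'rV[R]_n) : R :=
  Num.sqrt (\sum_(i < n) x 0 i ^+ 2).

Definition euclid_dist (R : realType) (n : nat) (theta : 'rV[R]_n)
    (L : set 'rV[R]_n) : R :=
  inf [set enorm (theta - P) | P in L].

Definition rational_affine (R : realType) (n d : nat) (L : set 'rV[R]_n) :
    Prop :=
  exists (p : 'rV[rat]_n) (V : 'M[rat]_(d, n)),
    row_free V /\
    L = [set x | exists t : 'rV[R]_d,
                   x = map_mx ratr p + t *m map_mx ratr V].

Definition homog (R : realType) (n : nat) (x : 'rV[R]_n) : 'rV[R]_(1 + n) :=
  row_mx 1%:M x.

Definition linear_hull (R : realType) (n : nat) (L : set 'rV[R]_n) :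
    set 'rV[R]_(1 + n) :=
  [set v | exists (k : nat) (c : 'I_k -> R) (x : 'I_k -> 'rV[R]_n),
             (forall i, L (x i)) /\ v = \sum_(i < k) c i *: homog (x i)].

Definition integer_points (R : realType) (m : nat) (S : set 'rV[R]_m) :
    set 'rV[int]_m :=
  [set z | S (map_mx intr z)].

(* The rows of B form a basis of the subgroup Lambda of Z^m. *)
Definition lattice_basis (m k : nat) (Lambda : set 'rV[int]_m)
    (B : 'M[int]_(k, m)) : Prop :=
  set_bij [set: 'rV[int]_k] Lambda (fun c => c *m B).

(* The covolume is the square root of the Gram determinant of a basis; it is
   the same for every basis, so the value selected by xget is the only
   candidate. *)
Definition covolume (R : realType) (m : nat) (Lambda : set 'rV[int]_m) : R :=
  xget 0 [set h | exists (k : nat) (B : 'M[int]_(k, m)),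
                    lattice_basis Lambda B /\
                    h = Num.sqrt (\det (B *m B^T))%:~R].

Definition height (R : realType) (n : nat) (L : set 'rV[R]_n) : R :=
  covolume R (integer_points (linear_hull L)).

(* A supremum in \bar R, so that the value +oo is allowed. *)
Definition uniform_exponent (R : realType) (n d : nat) (theta : 'rV[R]_n) :
    \bar R :=
  ereal_sup [set w%:E | w in
    [set w : R | \forall H \near +oo,
       exists L : set 'rV[R]_n,
         [/\ rational_affine d L, height L <= H &
             height L * euclid_dist theta L <= H `^ (- w)]]].

Definition one_lin_indep (R : realType) (n : nat) (theta : 'rV[R]_n) : Prop :=
  forall (a0 : rat) (a : 'I_n -> rat),
    ratr a0 + \sum_(i < n) ratr (a i) * theta 0 i = 0 ->
    a0 = 0 /\ forall i, a i = 0.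

Definition lambda_interval (R : realType) (n : nat) (omega : \bar R) : set R :=
  match omega with
  | w%:E%E => [set l | (w - 1) / ((n%:R - 1) * w) <= l <= (w - n%:R + 1) / w]
  | +oo%E => [set l | 1 / (n%:R - 1) <= l <= 1]
  | -oo%E => set0
  end.

(* Main.v *)
(* Points and forms are produced by a slow multidimensional continued fraction.
   Integer points Y_t of Z^(n+1) follow Y_(t+n+1) = c_t Y_(t+n) + Y_t from the
   standard basis; the dual bases of the windows (Y_t, ..., Y_(t+n)) consist of
   integer forms F_t with F_(t+n+1) = F_t - c_t F_(t+1).  Let u = (1, theta) be the
   limit direction of the Y_t and let A_(t+n+1) = c_t A_(t+1).  Up to factors
   exp(O(t)), F_t has size A_t, Y_(t+n) has size N_(t+n) = A_(t+1) ... A_(t+n),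
   |F_t . u| = 1 / N_(t+n) and |Y_t - N_t u| = 1 / A_(t+1).  As n+1 consecutive F's
   (or Y's) have no common zero, they also show that nothing approximates theta
   better, so both exponents are read off from the sequence log A_t, which the
   partial quotients c_t can make follow any prescribed profile.

   The profile has period n+1: log A_t runs through l_k, p_1 h_k, ..., p_n h_k with
   l_k << h_k << l_(k+1).  Only the window p_1 h_k, ..., p_n h_k matters: it gives the
   exponents 1 / min p_i and max p_i, and weights p_i of sum 1 with min p_i = 1 / omega
   and max p_i = lambda exist exactly when lambda lies in the stated interval.
   A free bit in every c_t yields uncountably many theta, since the c_t are recovered
   from theta by Euclidean division. *)
Require Import Defs.
From mathcomp Require Import all_boot all_order all_algebra.
From mathcomp Require Import all_classical all_reals all_analysis.
From mathcomp Require Import ring lra zify.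

Set Implicit Arguments.
Unset Strict Implicit.
Unset Printing Implicit Defensive.

Import Order.TTheory GRing.Theory Num.Theory.
Import numFieldNormedType.Exports.

Local Open Scope classical_set_scope.
Local Open Scope ring_scope.

(** * Recurrences of order n+1 *)

(** The order of the weights decides which bounds are sharp: the largest, [lam], follows the low
    value, and the smallest, [vp], ends the period. Write s = k(n+1). The form [F_s] costs l_k and,
    as the weights sum to 1, has log-value about -h_k; the next useful form, [F_(s+n)], becomes
    affordable at log-height p_n h_k. The worst ratio for forms is thus 1 / p_n. The point [Y_s]
    costs about l_k and has log-error -p_1 h_k; it must serve up to log-height h_k, where [Y_(s+n)]
    takes over with log-error -l_(k+1). The worst ratio for points is thus p_1. Testing against a
    whole window gives opposite bounds that see only the smallest and the largest weight, so both
    sides agree. The other weights only adjust the sum to 1. The profile cannot be followed exactly: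
    [A_(t+n+1)] is a multiple of [A_(t+1)] and must dominate [A_t], so earlier scales enter as
    errors. Letting each of l_k, h_k, l_(k+1) be negligible against the next absorbs them. This also
    covers omega = +oo, where p_n = 0 and the scale at s+n keeps log-size about l_k. *)

Lemma window_rec (T : Type) (n : nat) (init : nat -> T)
    (G : nat -> T -> T -> T -> T) : (0 < n)%N ->
  exists a : nat -> T, (forall i, (i <= n)%N -> a i = init i) /\
    forall t, a (t + n).+1 = G t (a t) (a t.+1) (a (t + n)%N).
Proof.
move=> n0.
pose step t (w : nat -> T) i :=
  if i == n then G t (w 0) (w 1) (w n) else w i.+1.
pose w := fix w t := if t is s.+1 then step s (w s) else init.
have shift t i : (i <= n)%N -> w t i = w (t + i)%N 0.
  elim: i t => [|i IH] t le_in; first by rewrite addn0.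
  rewrite addnS -addSn -IH ?(ltnW le_in) //= /step ifN //.
  by rewrite neq_ltn le_in.
exists (w ^~ 0); split=> [i le_in|t]; first by rewrite -[i in LHS]add0n -shift.
rewrite -addSn -[LHS]shift //= /step eqxx (shift t n) //.
by rewrite ifN // eq_sym -lt0n.
Qed.

Lemma window_ind (n : nat) (P : nat -> Prop) : (forall i, (i <= n)%N -> P i) ->
  (forall t, (forall s, (s <= t + n)%N -> P s) -> P (t + n).+1) ->
  forall t, P t.
Proof.
move=> P0 PS t; elim/ltn_ind: t => t IH.
have [/P0//|lt_nt] := leqP t n.
have e : t = ((t - n.+1) + n).+1 by lia.
by rewrite e; apply: PS => s le_s; apply: IH; rewrite e ltnS.
Qed.

Section Recurrences.
Variables (n : nat) (c : nat -> nat).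
Hypothesis n_gt0 : (0 < n)%N.

Definition point_rec (V : zmodType) (y : nat -> V) :=
  forall t, y (t + n).+1 = y (t + n)%N *+ c t + y t.

Definition form_rec (V : zmodType) (f : nat -> V) :=
  forall t, f (t + n).+1 = f t - f t.+1 *+ c t.

(** Each recurrence can be solved for its oldest term, so a window of zeros propagates back to the
    initial window. *)
Lemma point_rec_eq0 (V : zmodType) (y : nat -> V) (t : nat) : point_rec y ->
  (forall i, (i <= n)%N -> y (t + i)%N = 0) ->
  forall i, (i <= n)%N -> y i = 0.
Proof.
move=> rec; elim: t => [|t IH] h; first by move=> i /h.
have {}h i : (i <= n)%N -> y (t + i).+1 = 0 by rewrite -addSn; exact: h.
apply: IH => -[_|i lt_in]; last by rewrite addnS h // ltnW.
have := rec t; rewrite h // -{1}[n]prednK // addnS h ?leq_pred // mul0rn add0r.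
by rewrite addn0.
Qed.

Lemma form_rec_eq0 (V : zmodType) (f : nat -> V) (t : nat) : form_rec f ->
  (forall i, (i <= n)%N -> f (t + i)%N = 0) ->
  forall i, (i <= n)%N -> f i = 0.
Proof.
move=> rec; elim: t => [|t IH] h; first by move=> i /h.
have {}h i : (i <= n)%N -> f (t + i).+1 = 0 by rewrite -addSn; exact: h.
apply: IH => -[_|i lt_in]; last by rewrite addnS h // ltnW.
have := rec t; rewrite h // -[in f t.+1](addn0 t) h // mul0rn subr0 addn0.
by move=> <-.
Qed.

(** The pairing matrix of two windows is a cyclic shift: the oldest form is dual to the newest
    point. Moving the window creates one new row and one new column; in their common corner the two
    contributions [c t] cancel. *)
Lemma pairing_rec (D : nat -> nat -> int) :
  (forall s, point_rec (D s)) -> (forall t, form_rec (D ^~ t)) ->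
  (forall i j, (i <= n)%N -> (j <= n)%N ->
     D i j = ((i == 0) && (j == n) || (i == j.+1))%:R) ->
  forall t i j, (i <= n)%N -> (j <= n)%N ->
     D (t + i)%N (t + j)%N = ((i == 0) && (j == n) || (i == j.+1))%:R.
Proof.
move=> pD fD D0; elim=> [//|t IH] i j.
have IH0 k : (k <= n)%N -> D t (t + k)%N = (k == n)%:R.
  by move=> kn; have := IH 0%N k isT kn; rewrite addn0 /= orbF.
have IHt k : (k <= n)%N -> D (t + k)%N t = (k == 1%N)%:R.
  move=> kn; have := IH k 0%N kn isT; rewrite addn0.
  by rewrite (ltn_eqF n_gt0) andbF.
have lastD k : (k < n)%N -> D (t + k.+1)%N (t + n).+1 = (k == 0%N)%:R.
  move=> lt_kn; rewrite pD IH // IHt //= eqSS.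
  by rewrite (ltn_eqF lt_kn) mul0rn add0r.
have D0t : D t (t + n).+1 = (c t)%:R.
  rewrite pD IH0 // eqxx; have := IHt 0%N isT; rewrite addn0 => ->.
  by rewrite addr0.
have lastF k : (k < n)%N -> D (t + n).+1 (t + k.+1)%N = (k.+1 == n)%:R.
  move=> lt_kn; rewrite fD IH0 // -[in D t.+1 _]addn1 IH //=.
  by rewrite mul0rn subr0.
rewrite leq_eqVlt => /predU1P[->|lt_in]; rewrite leq_eqVlt => /predU1P[->|lt_jn].
- rewrite !addSn fD D0t -[in D t.+1 _]addn1 lastD // subrr.
  by rewrite (gtn_eqF n_gt0) /= ltn_eqF.
- by rewrite !addSn -[(t + j).+1]addnS lastF // eq_sym (gtn_eqF n_gt0) orFb eq_sym.
- rewrite !addSn -[(t + i).+1]addnS lastD //.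
  by rewrite eqxx andbT [i == n.+1]ltn_eqF ?orbF // ltnW.
- rewrite !addSn -!addnS IH //= !eqSS.
  by rewrite (ltn_eqF lt_jn) andbF.
Qed.

End Recurrences.

(** * Convergence and size estimates *)

Section Approximation.
Variables (n : nat) (c A : nat -> nat).
Hypothesis n_gt1 : (1 < n)%N.
Hypothesis A_init : forall i, (i <= n)%N -> A i = 1%N.
Hypothesis A_rec : forall t, A (t + n).+1 = (c t * A t.+1)%N.
Hypothesis A_grow : forall t, (4 ^ n.+1 * A t <= A (t + n).+1)%N.

Lemma scale_gt0 t : (0 < A t)%N.
Proof.
elim/(@window_ind n): t => [i /A_init->//|t IH].
by apply: leq_trans (A_grow t); rewrite muln_gt0 expn_gt0 IH // leq_addr.
Qed.

Lemma scale_ge_exp4 t : (4 ^ t <= 4 ^ n * A t)%N.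
Proof.
elim/(@window_ind n): t => [i le_in|t IH].
  by rewrite A_init // muln1 leq_exp2l.
apply: leq_trans (leq_mul (leqnn _) (A_grow t)).
by rewrite mulnCA -addnS expnD mulnC leq_mul2l IH ?leq_addr ?orbT.
Qed.

Variable R : realType.
Implicit Types (e f y N : nat -> R).

Lemma scaleR_gt0 t : 0 < (A t)%:R :> R.
Proof. by rewrite ltr0n scale_gt0. Qed.

(* [e t = y t - N t * (y s / N s)] measures the distance from the point of index [t]
   to the direction of a later point; it vanishes at [s].  The bound is read off at the
   index that maximises [|e i| * A i.+1 / 2 ^ i]. *)
Lemma backward_bound e s : point_rec n c e -> (forall i, (i < n)%N -> `|e i| <= 1) ->
  e s = 0 -> forall m, (m <= s)%N -> `|e m| <= 2 ^+ m / (A m.+1)%:R.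
Proof.
move=> rec init es m le_ms.
pose x (i : nat) := `|e i| * (A i.+1)%:R / 2 ^+ i.
have xE i : `|e i| = x i * (2 ^+ i / (A i.+1)%:R).
  rewrite /x; have := scaleR_gt0 i.+1; have : 0 < 2 ^+ i :> R by rewrite exprn_gt0.
  by move=> *; field; lra.
suff : x m <= 1.
  by move=> h; rewrite xE ler_piMl.
case: (@arg_maxP _ _ _ (inord m : 'I_s.+1) xpredT (fun i => x i) isT) => i _ xmax'.
have {}xmax' k : (k <= s)%N -> x k <= x i.
  by move=> le_ks; have := xmax' (inord k) isT; rewrite /= inordK.
apply: le_trans (xmax' _ le_ms) _.
have x0 : 0 <= x i by rewrite divr_ge0 ?exprn_ge0 ?mulr_ge0.
have [lt_in|le_ni] := ltnP i n.
  rewrite /x A_init // mulr1 ler_pdivrMr ?exprn_gt0 // mul1r.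
  by rewrite (le_trans (init _ lt_in)) // exprn_ege1 // ler1n.
have [eis|neq_is] := eqVneq (i : nat) s; first by rewrite /x eis es normr0 !mul0r.
have lt_is : (i < s)%N by have := ltn_ord i; lia.
pose t := (i - n)%N.
have ei : i = (t + n)%N :> nat by rewrite subnK.
have h1 := xmax' i.+1 lt_is.
have h2 := xmax' t (leq_trans (leq_subr _ _) (ltnW lt_is)).
have := rec t; rewrite -ei => eqn.
have cle : `|e i| * (c t)%:R <= `|e i.+1| + `|e t|.
  rewrite -normr_nat -normrM mulr_natr.
  have -> : e i *+ c t = e i.+1 - e t by rewrite eqn addrK.
  by rewrite (le_trans (ler_normB _ _)).
rewrite !xE in cle.
have gA : 4 * (A t.+1)%:R <= (A i.+2)%:R :> R.
  rewrite ei -natrM ler_nat; apply: leq_trans (A_grow t.+1).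
  by rewrite leq_mul2r expnS leq_pmulr ?expn_gt0 ?orbT.
have rA : (A i.+1)%:R = (c t)%:R * (A t.+1)%:R :> R by rewrite ei A_rec natrM.
have p1 := scaleR_gt0 t.+1; have p2 := scaleR_gt0 i.+1; have p3 := scaleR_gt0 i.+2.
have c0 : 0 < (c t)%:R :> R by move: p2; rewrite rA pmulr_lgt0.
have l1 : x i * (2 ^+ i / (A i.+1)%:R) * (c t)%:R = x i * 2 ^+ i / (A t.+1)%:R.
  by rewrite rA; field; lra.
rewrite l1 in cle.
have q0 : 0 < 2 ^+ i :> R by rewrite exprn_gt0.
(* By maximality the two neighbours contribute at most 1/2 and 1/4 of the main term: the later one
   because [A i.+2] is at least [4 * A t.+1], the earlier one because [i = t + n] with [n] at least
   2. So the main term is nonpositive. *)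
have l2 : x i.+1 * (2 ^+ i.+1 / (A i.+2)%:R) <= x i * 2 ^+ i / (A t.+1)%:R / 2.
  apply: le_trans (ler_wpM2r _ h1) _; first by rewrite divr_ge0 ?exprn_ge0.
  rewrite -[in leRHS](mulrA (x i)) -[in leRHS](mulrA (x i)); apply: ler_wpM2l => //.
  rewrite exprS ler_pdivrMr // -!mulrA [leLHS]mulrC (ler_wpM2l (ltW q0)) //.
  by rewrite ler_pdivlMl //; lra.
have l3 : x t * (2 ^+ t / (A t.+1)%:R) <= x i * 2 ^+ i / (A t.+1)%:R / 4.
  apply: le_trans (ler_wpM2r _ h2) _; first by rewrite divr_ge0 ?exprn_ge0.
  rewrite -[in leRHS](mulrA (x i)) -[in leRHS](mulrA (x i)); apply: ler_wpM2l => //.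
  rewrite mulrAC ler_wpM2r ?invr_ge0 ?(ltW p1) //.
  rewrite ler_pdivlMr // ei exprD ler_wpM2l ?exprn_ge0 //.
  have -> : 4 = 2 ^+ 2 :> R by rewrite expr2 -natrM.
  by apply: ler_weXn2l; rewrite ?ler1n.
suff : x i * 2 ^+ i / (A t.+1)%:R <= 0.
  rewrite -mulrA pmulr_lle0 ?divr_gt0 ?exprn_gt0 // => h.
  exact: le_trans h ler01.
set z := x i * 2 ^+ i / (A t.+1)%:R in cle l2 l3 *; lra.
Qed.

(** The term [f t.+1 *+ c t] grows exactly as [A] does; the factor [2 ^+ t] pays for the other term,
    since [A t <= A (t + n).+1]. *)
Lemma form_growth f : form_rec n c f -> (forall i, (i <= n)%N -> `|f i| <= 1) ->
  forall t, `|f t| <= 2 ^+ t * (A t)%:R.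
Proof.
move=> rec init; elim/(@window_ind n) => [i le_in|t IH].
  rewrite A_init // mulr1 (le_trans (init _ le_in)) //.
  by rewrite exprn_ege1 // ler1n.
have h1 := IH t (leq_addr _ _).
have h2 : `|f t.+1| <= 2 ^+ t.+1 * (A t.+1)%:R by apply: IH; lia.
rewrite rec (le_trans (ler_normB _ _)) // normrMn -(mulr_natr `|f t.+1|).
have h3 : (A t)%:R <= (A (t + n).+1)%:R :> R.
  rewrite ler_nat (leq_trans _ (A_grow t)) // leq_pmull // expn_gt0 //.
have h4 : `|f t.+1| * (c t)%:R <= 2 ^+ t.+1 * (A (t + n).+1)%:R.
  rewrite A_rec natrM mulrCA [leRHS]mulrC ler_wpM2r //.
have h5 : (2 ^+ t + 2 ^+ t.+1) <= 2 ^+ (t + n).+1 :> R.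
  apply: le_trans (_ : 2 ^+ t.+2 <= _).
    rewrite !exprS; have : 0 <= 2 ^+ t :> R by rewrite exprn_ge0. lra.
  by apply: ler_weXn2l; [rewrite ler1n|lia].
have h6 : `|f t| <= 2 ^+ t * (A (t + n).+1)%:R.
  by rewrite (le_trans h1) // ler_wpM2l // exprn_ge0.
by rewrite (le_trans (lerD h6 h4)) // -mulrDl ler_wpM2r.
Qed.

Section Denominators.
Variable N : nat -> R.
Hypothesis N_rec : point_rec n c N.
Hypothesis N_init : forall i, (i < n)%N -> N i = 0.
Hypothesis N_n : N n = 1.

Lemma denom_gt0_ge0 t : (0 <= N t) /\ ((n <= t)%N -> 0 < N t).
Proof.
elim/(@window_ind n): t => [i|t IH].
  rewrite leq_eqVlt => /predU1P[->|lt_in]; first by rewrite N_n ltr01 ler01.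
  by rewrite N_init // lexx leqNgt lt_in.
have c0 : (0 < c t)%N.
  rewrite lt0n; apply/negP => /eqP e.
  by have := A_rec t; rewrite e mul0n => h; have := scale_gt0 (t + n).+1; rewrite h.
have [_ /(_ (leq_addl _ _)) h1] := IH (t + n)%N (leqnn _).
have [h2 _] := IH t (leq_addr _ _).
suff : 0 < N (t + n).+1 by move=> h; split=> // ; exact: ltW.
by rewrite N_rec -mulr_natr ltr_wpDr // mulr_gt0 // ltr0n.
Qed.

Lemma denom_ge0 t : 0 <= N t. Proof. by case: (denom_gt0_ge0 t). Qed.

Lemma denom_gt0 t : (n <= t)%N -> 0 < N t. Proof. by case: (denom_gt0_ge0 t). Qed.

Lemma coef_gt0 t : (0 < c t)%N.
Proof.
have := scale_gt0 (t + n).+1.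
by rewrite A_rec muln_gt0 => /andP[].
Qed.

Lemma denom_leS t : N t <= N t.+1.
Proof.
have [lt_tn|le_nt] := ltnP t n; first by rewrite N_init ?denom_ge0.
have -> : t = (t - n + n)%N by rewrite subnK.
rewrite N_rec -mulr_natr.
have h1 := denom_ge0 (t - n + n); have h2 := denom_ge0 (t - n).
have h3 : 1 <= (c (t - n))%:R :> R by rewrite ler1n coef_gt0.
nra.
Qed.

Lemma denom_le s t : (s <= t)%N -> N s <= N t.
Proof.
move=> /subnK<-; elim: (t - s)%N => [//|k IH].
by rewrite addSn (le_trans IH) // denom_leS.
Qed.

(** Nested intervals: by [fin], the quotient [y m / N m] lies in [[lo s, hi s]] for every [s]
    between [n] and [m]. These intervals therefore meet pairwise, and the supremum of their left
    ends lies in all of them. *)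
Lemma limit_exists y : point_rec n c y -> (forall i, (i < n)%N -> `|y i| <= 1) ->
  exists theta, forall t, `|y t - N t * theta| <= 2 ^+ t / (A t.+1)%:R.
Proof.
move=> y_rec y_init.
have B0 t : 0 < 2 ^+ t / (A t.+1)%:R :> R.
  by rewrite divr_gt0 ?exprn_gt0 ?scaleR_gt0.
have fin s m : (n <= s)%N -> (m <= s)%N ->
    `|y m - N m * (y s / N s)| <= 2 ^+ m / (A m.+1)%:R.
  move=> le_ns le_ms.
  apply: (@backward_bound (fun m => y m - N m * (y s / N s)) s) => //.
  - by move=> t; rewrite y_rec N_rec mulrDl mulrnAl opprD addrACA mulrnBl.
  - by move=> i lt_in; rewrite N_init // mul0r subr0 y_init.
  - by rewrite mulrC divfK ?subrr // gt_eqF // denom_gt0.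
pose lo t := (y t - 2 ^+ t / (A t.+1)%:R) / N t.
pose hi t := (y t + 2 ^+ t / (A t.+1)%:R) / N t.
have lohi s t : (n <= s)%N -> (n <= t)%N -> lo s <= hi t.
  move=> le_ns le_nt; pose m := maxn s t.
  have le_nm : (n <= m)%N by rewrite leq_max le_ns.
  apply: (@le_trans _ _ (y m / N m)).
    rewrite /lo ler_pdivrMr ?denom_gt0 //.
    have := fin m s le_nm (leq_maxl _ _).
    by rewrite ler_norml => /andP[_]; lra.
  rewrite /hi ler_pdivlMr ?denom_gt0 //.
  have := fin m t le_nm (leq_maxr _ _).
  by rewrite ler_norml => /andP[]; lra.
pose E : set R := [set lo t | t in [set t | (n <= t)%N]].
have E0 : E !=set0 by exists (lo n), n => //=.
have Eub t : (n <= t)%N -> ubound E (hi t).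
  by move=> le_nt _ [s /= le_ns <-]; exact: lohi.
exists (sup E) => t; have [lt_tn|le_nt] := ltnP t n.
  rewrite N_init // mul0r subr0 (le_trans (y_init _ lt_tn)) // A_init // divr1.
  by rewrite exprn_ege1 // ler1n.
have h1 : sup E <= hi t by apply: ge_sup => //; exact: Eub.
have h2 : lo t <= sup E.
  by apply: ub_le_sup; [exists (hi t); exact: Eub|exists t].
rewrite /hi ler_pdivlMr ?denom_gt0 // in h1.
rewrite /lo ler_pdivrMr ?denom_gt0 // in h2.
by rewrite ler_norml; apply/andP; split; lra.
Qed.

End Denominators.

End Approximation.

(** * The points, the dual forms and the limit direction *)

Definition dot (K : pzRingType) (m : nat) (x y : 'rV[K]_m) : K :=
  \sum_i x 0 i * y 0 i.

Section Dot.
Variables (K : comPzRingType) (m : nat).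
Implicit Types x y : 'rV[K]_m.

Lemma dotC x y : dot x y = dot y x.
Proof. by apply: eq_bigr => i _; rewrite mulrC. Qed.

Lemma dotDr x y z : dot x (y + z) = dot x y + dot x z.
Proof. by rewrite -big_split; apply: eq_bigr => i _; rewrite mxE mulrDr. Qed.

Lemma dotZr x a y : dot x (a *: y) = a * dot x y.
Proof. by rewrite mulr_sumr; apply: eq_bigr => i _; rewrite mxE mulrCA. Qed.

Lemma dotNr x y : dot x (- y) = - dot x y.
Proof. by rewrite -scaleN1r dotZr mulN1r. Qed.

Lemma dotMnr x y k : dot x (y *+ k) = dot x y *+ k.
Proof. by rewrite -scaler_nat dotZr mulr_natl. Qed.

Lemma dot_delta i y : dot (delta_mx 0 i) y = y 0 i.
Proof.
rewrite /dot (bigD1 i) //= mxE !eqxx mul1r big1 ?addr0 // => j ne_ji.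
by rewrite mxE (negPf ne_ji) andbF mul0r.
Qed.

End Dot.

Lemma row_subZE (K : pzRingType) (m : nat) (x y : 'rV[K]_m) a i :
  (x - a *: y) 0 i = x 0 i - a * y 0 i.
Proof. by rewrite !mxE. Qed.

Lemma dot_norm_le (K : numDomainType) (m : nat) (x y : 'rV[K]_m) (a b : K) :
  (forall i, `|x 0 i| <= a) -> (forall i, `|y 0 i| <= b) ->
  `|dot x y| <= m%:R * (a * b).
Proof.
move=> xa yb; rewrite (le_trans (ler_norm_sum _ _ _)) //.
rewrite -[m in leRHS]card_ord mulr_natl -sumr_const ler_sum // => i _.
by rewrite normrM ler_pM.
Qed.

Lemma dot_intr (R : pzRingType) (m : nat) (x y : 'rV[int]_m) :
  dot (map_mx intr x) (map_mx intr y) = (dot x y)%:~R :> R.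
Proof. by rewrite rmorph_sum; apply: eq_bigr => i _; rewrite !mxE rmorphM. Qed.

Section Construction.
Variables (n : nat) (c A : nat -> nat).
Hypothesis n_gt1 : (1 < n)%N.
Hypothesis A_init : forall i, (i <= n)%N -> A i = 1%N.
Hypothesis A_rec : forall t, A (t + n).+1 = (c t * A t.+1)%N.
Hypothesis A_grow : forall t, (4 ^ n.+1 * A t <= A (t + n).+1)%N.
Hypothesis c_gt1 : forall t, (1 < c t)%N.
Variables Y F : nat -> 'rV[int]_(1 + n).
Hypothesis Y_rec : point_rec n c Y.
Hypothesis F_rec : form_rec n c F.
Hypothesis Y_init : forall j, (j <= n)%N ->
  Y j = delta_mx 0 (inord (if j == n then 0%N else j.+1)).
Hypothesis F_init : forall i, (i <= n)%N -> F i = delta_mx 0 (inord i).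
Let n_gt0 : (0 < n)%N := ltnW n_gt1.

(** Starting the points with e_1, ..., e_n and then e_0 makes the denominators vanish before index
    [n], and matches them with the forms e_0, ..., e_n by the cyclic shift that [pairing_rec]
    propagates. *)
Lemma dot_initE i j : (i <= n)%N -> (j <= n)%N ->
  dot (F i) (Y j) = ((i == 0) && (j == n) || (i == j.+1))%:R.
Proof.
move=> le_in le_jn; rewrite F_init // dot_delta Y_init // mxE eqxx /=.
congr _%:R; rewrite -val_eqE /= !inordK; first 1 last.
- by case: ifP => // ne_jn; rewrite ltnS ltn_neqAle ne_jn.
- by [].
have [->|_] := eqVneq j n; last by rewrite andbF.
by rewrite andbT [i == n.+1]ltn_eqF ?orbF.
Qed.

Lemma dot_pairing t i j : (i <= n)%N -> (j <= n)%N ->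
  dot (F (t + i)%N) (Y (t + j)%N) = ((i == 0) && (j == n) || (i == j.+1))%:R.
Proof.
apply: (@pairing_rec n c n_gt0 (fun s t => dot (F s) (Y t))).
- by move=> s u; rewrite Y_rec dotDr dotMnr.
- move=> u s; rewrite F_rec !(dotC _ (Y u)).
  by rewrite dotDr dotNr dotMnr.
- exact: dot_initE.
Qed.

Lemma dot_form_last t : dot (F t) (Y (t + n)%N) = 1.
Proof.
by have := @dot_pairing t 0%N n isT (leqnn _); rewrite addn0 eqxx.
Qed.

Lemma forms_separate t y : (forall i, (i <= n)%N -> dot (F (t + i)%N) y = 0) -> y = 0.
Proof.
move=> h; have h0 : forall i, (i <= n)%N -> dot (F i) y = 0.
  apply: (@form_rec_eq0 n c _ (fun s => dot (F s) y) t) => // s.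
  by rewrite F_rec !(dotC _ y) dotDr dotNr dotMnr.
apply/rowP => i; have le_in : (i <= n)%N by rewrite -ltnS.
by rewrite [RHS]mxE -(h0 i) // F_init // dot_delta inord_val.
Qed.

Lemma points_separate t x : (forall i, (i <= n)%N -> dot x (Y (t + i)%N) = 0) -> x = 0.
Proof.
move=> h; have h0 : forall i, (i <= n)%N -> dot x (Y i) = 0.
  apply: (@point_rec_eq0 n c n_gt0 _ (fun s => dot x (Y s)) t) => // s.
  by rewrite Y_rec dotDr dotMnr.
apply/rowP => i; rewrite [RHS]mxE.
pose j := if (i == 0 :> nat) then n else i.-1.
have le_jn : (j <= n)%N.
  by rewrite /j; case: ifP => // _; have := ltn_ord i; lia.
rewrite -(h0 j) // Y_init // dotC dot_delta; congr (x _ _).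
apply/val_inj; rewrite /= inordK; last first.
  by case: ifP => // /negbT ne_jn; rewrite ltnS ltn_neqAle ne_jn.
rewrite /j; have [->|i0] := eqVneq (i : nat) 0%N; first by rewrite eqxx.
by have := ltn_ord i; case: eqP; lia.
Qed.

(** In [j] the pairing follows the recurrence of the points, whose coefficients are nonnegative,
    from the window 0, ..., 0, 1. This sign is what fixes the sign of the limit values. *)
Lemma dot_form_ge0 t j : 0 <= dot (F t) (Y (t + j)%N).
Proof.
elim/(@window_ind n): j => [j le_jn|j IH].
  by have := @dot_pairing t 0%N j isT le_jn; rewrite addn0 => ->.
rewrite addnS addnA Y_rec dotDr dotMnr addr_ge0 ?mulrn_wge0 //.
  by rewrite -addnA IH.
by rewrite IH // leq_addr.
Qed.

Section Limit.
Variables (R : realType) (theta : 'rV[R]_n).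
Let u := homog theta.
Let Z (v : 'rV[int]_(1 + n)) : 'rV[R]_(1 + n) := map_mx intr v.
Let N t : R := (Y t 0 0)%:~R.
Hypothesis theta_approx : forall t i,
  `|(Y t 0 i)%:~R - N t * u 0 i| <= 2 ^+ t / (A t.+1)%:R.

Let A0 t : 0 < (A t)%:R :> R := scaleR_gt0 A_init A_grow R t.

Lemma denom_rec : point_rec n c N.
Proof.
by move=> t; rewrite /N Y_rec !mxE mulmxnE intrD rmorphMn.
Qed.

Lemma denom_init i : (i < n)%N -> N i = 0.
Proof.
move=> lt_in; rewrite /N (Y_init (ltnW lt_in)) mxE ltn_eqF //=.
by rewrite -val_eqE /= inordK.
Qed.

Lemma denom_n : N n = 1.
Proof. by rewrite /N Y_init // mxE !eqxx -val_eqE /= inordK. Qed.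

Lemma denom_mono s t : (s <= t)%N -> N s <= N t.
Proof.
by apply: (denom_le A_init A_rec A_grow denom_rec denom_init denom_n).
Qed.

Lemma denom_pos t : (n <= t)%N -> 0 < N t.
Proof.
by apply: (denom_gt0 A_init A_rec A_grow denom_rec denom_init denom_n).
Qed.

Lemma denom_nneg t : 0 <= N t.
Proof.
by apply: (denom_ge0 A_init A_rec A_grow denom_rec denom_init denom_n).
Qed.

Lemma denom_exp2 t : 2 ^+ t <= N (t + n)%N.
Proof.
elim: t => [|t IH]; first by rewrite denom_n.
rewrite addSn denom_rec exprS.
have h := denom_nneg t; have h' : 2 <= (c t)%:R :> R by rewrite ler_nat.
have h0 : 0 < 2 ^+ t :> R by rewrite exprn_gt0.
rewrite -(mulr_natr (N _)); nra.
Qed.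

Lemma form_bound t i : `|(F t 0 i)%:~R : R| <= 2 ^+ t * (A t)%:R.
Proof.
apply: (form_growth n_gt1 A_init A_rec A_grow (f := fun t => (F t 0 i)%:~R)).
  by move=> s; rewrite F_rec !mxE mulmxnE intrB rmorphMn /=.
by move=> j le_jn; rewrite F_init // mxE; case: (_ && _); rewrite ?normr0 ?normr1.
Qed.

Lemma error_small t i : `|(Y t 0 i)%:~R - N t * u 0 i| <= 4 ^+ n / 2 ^+ t.
Proof.
rewrite (le_trans (theta_approx _ _)) //.
rewrite ler_pdivrMr // mulrAC ler_pdivlMr ?exprn_gt0 //.
have -> : 2 ^+ t * 2 ^+ t = 4 ^+ t :> R.
  by rewrite -exprMn -natrM.
apply: (@le_trans _ _ (4 ^+ t.+1)); first by apply: ler_weXn2l; rewrite ?ler1n.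
rewrite -!natrX -natrM ler_nat.
exact: scale_ge_exp4 A_init A_grow _.
Qed.

Lemma dot_decomp x t :
  (dot x (Y t))%:~R = dot (Z x) (Z (Y t) - N t *: u) + N t * dot (Z x) u.
Proof.
by rewrite dotDr dotNr dotZr -addrA addNr addr0 dot_intr.
Qed.

Lemma errorE t i : (Z (Y t) - N t *: u) 0 i = (Y t 0 i)%:~R - N t * u 0 i.
Proof. by rewrite row_subZE [Z _ _ _]mxE. Qed.

(** The integer 1 = F_t . Y_(t+n) is split into N_(t+n) times the value at [u] and an error; in the
    error the factors [A t] and [1 / A (t + n).+1] compensate, leaving powers of 2. *)
Lemma form_value_bound t :
  `|dot (Z (F t)) u| <= (1 + (1 + n)%:R * 4 ^+ (t + n)) / N (t + n)%N.
Proof.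
rewrite ler_pdivlMr ?denom_pos ?leq_addl //.
have := dot_decomp (F t) (t + n)%N; rewrite dot_form_last.
set d := dot _ (_ - _) => h.
have -> : `|dot (Z (F t)) u| * N (t + n)%N = `|1 - d|.
  rewrite -[N _ in LHS]ger0_norm ?denom_nneg // -normrM.
  by congr `|_|; rewrite -[1]/(1%:~R) h; ring.
rewrite (le_trans (ler_normB _ _)) // normr1 lerD2l.
apply: le_trans (dot_norm_le (a := 2 ^+ t * (A t)%:R)
  (b := 2 ^+ (t + n)%N / (A (t + n).+1)%:R) _ _) _.
- by move=> i; rewrite mxE form_bound.
- by move=> i; rewrite errorE theta_approx.
rewrite ler_wpM2l // mulrA ler_pdivrMr // -mulrA mulrCA.
have le_A : (A t)%:R <= (A (t + n).+1)%:R :> R.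
  by rewrite ler_nat (leq_trans _ (A_grow t)) // leq_pmull // expn_gt0.
rewrite [leRHS]mulrC ler_pM ?mulr_ge0 ?exprn_ge0 //.
have -> : 4 = 2 * 2 :> R by rewrite -natrM.
rewrite exprMn ler_pM ?exprn_ge0 //.
by apply: ler_weXn2l; rewrite ?ler1n ?leq_addr.
Qed.

(** If [x] kills [u], the integer [dot x (Y s)] equals its error term, which tends to 0. It
    therefore vanishes on a whole late window, and [points_separate] applies. Linear independence of
    1 and the coordinates of [theta] comes from here. *)
Lemma dot_int_eq0 x : dot (Z x) u = 0 -> x = 0.
Proof.
move=> h; pose a : R := \sum_i `|(x 0 i)%:~R|.
have xa i : `|Z x 0 i| <= a.
  by rewrite mxE /a (bigD1 i) //= lerDl sumr_ge0.
(* A natural bound of a real number also serves as an exponent: [2 ^+ t] exceeds it. *)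
pose t := Num.bound ((1 + n)%:R * (a * 4 ^+ n)).
apply: (@points_separate t) => i _.
have hd := dot_decomp x (t + i)%N; rewrite h mulr0 addr0 in hd.
suff : `|(dot x (Y (t + i)%N))%:~R : R| < 1.
  by rewrite -intr_norm -[1]/(1%:~R) ltr_int; lia.
rewrite hd.
apply: le_lt_trans (dot_norm_le xa (b := 4 ^+ n / 2 ^+ (t + i)%N) _) _.
  by move=> j; rewrite errorE error_small.
rewrite !mulrA ltr_pdivrMr ?exprn_gt0 // mul1r -mulrA.
exact: upper_nthrootP (leq_addr _ _).
Qed.

(** A negative value would be multiplied by the unbounded denominators while the error term stays
    bounded, contradicting [dot_form_ge0]. *)
Lemma form_value_gt0 t : 0 < dot (Z (F t)) u.
Proof.
rewrite lt_def; apply/andP; split.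
  apply/eqP => /dot_int_eq0 h; have := dot_form_last t.
  by rewrite h /dot big1 // => i _; rewrite mxE mul0r.
rewrite leNgt; apply/negP => f0; set f := dot _ u in f0.
pose K : R := (1 + n)%:R * (2 ^+ t * (A t)%:R * 4 ^+ n).
have K0 : 0 <= K by rewrite !mulr_ge0 ?exprn_ge0.
pose s := Num.bound (K / - f).
have := dot_decomp (F t) (t + (s + n))%N.
have := dot_form_ge0 t (s + n); rewrite -(ler0z R) => /[swap] ->.
rewrite leNgt => /negP; apply.
set d := dot _ (_ - _); have dK : d <= K.
  apply: le_trans (ler_norm _) _.
  apply: dot_norm_le => i; first by rewrite mxE form_bound.
  rewrite errorE (le_trans (error_small _ _)) // ler_piMr ?exprn_ge0 //.
  by rewrite invf_le1 ?exprn_gt0 // exprn_ege1 // ler1n.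
have : K / - f < 2 ^+ s by apply: upper_nthrootP.
rewrite ltr_pdivrMr ?oppr_gt0 // -/f => h1.
have h2 : 2 ^+ s <= N (t + (s + n))%N.
  by rewrite (le_trans (denom_exp2 s)) // denom_mono // leq_addl.
nra.
Qed.

Lemma form_value_rec : form_rec n c (fun t => dot (Z (F t)) u).
Proof.
move=> t; rewrite F_rec /Z map_mxB -scaler_nat map_mxZ rmorph_nat.
by rewrite !(dotC _ u) dotDr dotNr dotZr mulr_natl.
Qed.

End Limit.

Lemma theta_exists (R : realType) : exists theta : 'rV[R]_n, forall t i,
  `|(Y t 0 i)%:~R - (Y t 0 0)%:~R * homog theta 0 i| <= 2 ^+ t / (A t.+1)%:R.
Proof.
have H i : exists x : R, forall t,
    `|(Y t 0 i)%:~R - (Y t 0 0)%:~R * x| <= 2 ^+ t / (A t.+1)%:R.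
  apply: (limit_exists n_gt1 A_init A_rec A_grow (denom_rec R)
           (denom_init R) (denom_n R)).
    by move=> t; rewrite Y_rec !mxE mulmxnE intrD rmorphMn.
  move=> j lt_in; rewrite (Y_init (ltnW lt_in)) mxE.
  by case: (_ && _); rewrite ?normr1 ?normr0.
have /choice[f Hf] := H.
exists (\row_j f (rshift 1 j)) => t i; rewrite /homog mxE.
case: splitP => j; last by move=> ij; rewrite mxE; have -> : i = rshift 1 j by apply/val_inj.
rewrite !ord1 => i0; rewrite mxE eqxx mulr1.
have -> : i = 0 by apply/val_inj.
rewrite subrr normr0 divr_ge0 ?exprn_ge0 //.
Qed.

End Construction.

(** * Partial quotients realising a given profile *)

Section Scales.
Variables (R : realType) (n : nat) (tau : nat -> R) (b : nat -> bool).
Hypothesis n_gt1 : (1 < n)%N.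

Definition target s := Num.truncn (expR (tau s)).

(* The term in [4 ^ n.+1] makes [A] grow geometrically along each residue class,
   which is what the convergence needs; the bit [b t] is free. *)
Definition coef t a0 a1 : nat :=
  ((target (t + n).+1 + 4 ^ n.+1 * a0) %/ a1 + 2 + b t)%N.

Definition is_scale (A : nat -> nat) :=
  (forall i, (i <= n)%N -> A i = 1%N) /\
  forall t, A (t + n).+1 = (coef t (A t) (A t.+1) * A t.+1)%N.

Lemma scale_exists : exists A, is_scale A.
Proof.
exact: (window_rec (fun=> 1%N) (fun t a0 a1 _ => coef t a0 a1 * a1)%N (ltnW n_gt1)).
Qed.

Variable A : nat -> nat.
Hypothesis scaleA : is_scale A.

Lemma is_scale_gt0 t : (0 < A t)%N.
Proof.
case: scaleA => init rec; elim/(@window_ind n): t => [i /init->//|t IH].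
have a1 : (0 < A t.+1)%N by apply: IH; lia.
by rewrite rec muln_gt0 a1 /coef !addnS.
Qed.

Lemma is_scale_lb t : (target (t + n).+1 + 4 ^ n.+1 * A t < A (t + n).+1)%N.
Proof.
case: scaleA => _ ->; have := is_scale_gt0 t.+1; rewrite /coef.
set x := (_ + _)%N => a0; have := divn_eq x (A t.+1); have := ltn_pmod x a0.
nia.
Qed.

(** The 3 bounds the [2 + b t] added to the quotient in [coef]; the rest is the truncated
    division. *)
Lemma is_scale_ub t :
  (A (t + n).+1 <= target (t + n).+1 + 4 ^ n.+1 * A t + 3 * A t.+1)%N.
Proof.
case: scaleA => _ ->; have := is_scale_gt0 t.+1; rewrite /coef.
set x := (_ + _)%N => a0; have := leq_trunc_div x (A t.+1).
by case: (b t); nia.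
Qed.

Lemma is_scale_grow t : (4 ^ n.+1 * A t <= A (t + n).+1)%N.
Proof. by apply: leq_trans (ltnW (is_scale_lb t)); rewrite leq_addl. Qed.

Lemma coef_gt1 t a0 a1 : (1 < coef t a0 a1)%N.
Proof. by rewrite /coef addn2. Qed.

Lemma is_scale_exp_lb s : (n < s)%N -> expR (tau s) <= (A s)%:R.
Proof.
move=> lt_ns; have e : s = (s - n.+1 + n).+1 by lia.
have := is_scale_lb (s - n.+1); rewrite -e => h.
have /andP[_ h2] := truncn_itv (expR_ge0 (tau s)).
apply: le_trans (ltW h2) _; rewrite ler_nat.
by apply: leq_trans h; rewrite ltnS leq_addr.
Qed.

(** Logarithmic loss of one step: when all inputs are at most [expR M], the three terms of
    [is_scale_ub] add up to at most [1 + 4 ^ n.+1 + 3] times it. *)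
Definition scale_loss : R := ln (4 ^+ n.+1 + 4).

Lemma scale_loss_ge0 : 0 <= scale_loss.
Proof.
have h : 0 <= 4 ^+ n.+1 :> R by rewrite exprn_ge0.
by rewrite /scale_loss ln_ge0 //; lra.
Qed.

Lemma is_scale_exp_ub M t : tau (t + n).+1 <= M -> (A t)%:R <= expR M ->
  (A t.+1)%:R <= expR M -> (A (t + n).+1)%:R <= expR (scale_loss + M).
Proof.
move=> tM h1 h2; rewrite expRD lnK; last first.
  by rewrite posrE ltr_wpDl // exprn_ge0.
have /andP[h3 _] := truncn_itv (expR_ge0 (tau (t + n).+1)).
have : (A (t + n).+1)%:R <= (target (t + n).+1 + 4 ^ n.+1 * A t + 3 * A t.+1)%N%:R :> R.
  by rewrite ler_nat is_scale_ub.
rewrite !natrD !natrM natrX => h; apply: le_trans h _.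
have h4 : expR (tau (t + n).+1) <= expR M by rewrite ler_expR.
have h5 : 4 ^+ n.+1 * (A t)%:R <= 4 ^+ n.+1 * expR M by rewrite ler_wpM2l ?exprn_ge0.
rewrite /target; nra.
Qed.

Lemma is_scale_crude M t : 0 <= M -> (forall s, (s <= t)%N -> tau s <= M) ->
  (A t)%:R <= expR (M + scale_loss * t%:R).
Proof.
move=> M0; have K0 := scale_loss_ge0.
elim/(@window_ind n): t => [i le_in _|t IH tauM].
  by case: scaleA => -> // _; rewrite -expR0 ler_expR addr_ge0 // mulr_ge0.
have IH' s : (s <= t.+1)%N -> (A s)%:R <= expR (M + scale_loss * t.+1%:R).
  move=> le_st; have le_s : (s <= t + n)%N by lia.
  apply: le_trans (IH s le_s _) _.
    by move=> i le_is; apply: tauM; lia.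
  by rewrite ler_expR lerD2l ler_wpM2l // ler_nat.
apply: le_trans (is_scale_exp_ub _ (IH' t (leqnSn _)) (IH' t.+1 (leqnn _))) _.
  by apply: le_trans (tauM _ (leqnn _)) _; rewrite lerDl mulr_ge0.
rewrite ler_expR addrCA lerD2l -[X in X + _]mulr1 -mulrDr ler_wpM2l //.
by rewrite addrC natr1 ler_nat; lia.
Qed.

End Scales.

(** * The profile *)

Section Growth.
Variable R : realType.

(** Alternating factorials: each of [low k], [high k], [low k.+1] becomes negligible against the
    next, and the index [k] against [low k], which is what [growth] records. *)
Definition low k : R := (k.*2)`!%:R.
Definition high k : R := (k.*2.+1)`!%:R.

Lemma low_ge1 k : 1 <= low k.
Proof. by rewrite ler1n fact_gt0. Qed.

Lemma highE k : high k = (k.*2.+1)%:R * low k.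
Proof. by rewrite /high factS natrM. Qed.

Lemma lowS k : low k.+1 = (k.*2.+2)%:R * high k.
Proof. by rewrite /low doubleS factS natrM. Qed.

Lemma low_le_high k : low k <= high k.
Proof. by rewrite highE ler_peMl ?ler1n // (le_trans ler01) ?low_ge1. Qed.

Lemma high_le_low k : high k <= low k.+1.
Proof.
by rewrite lowS ler_peMl ?ler1n // (le_trans ler01) // (le_trans _ (low_le_high k)) ?low_ge1.
Qed.

Lemma low_mono k l : (k <= l)%N -> low k <= low l.
Proof.
by move=> le_kl; rewrite /low ler_nat leq_fact ?leq_double.
Qed.

Lemma high_mono k l : (k <= l)%N -> high k <= high l.
Proof.
by move=> le_kl; rewrite /high ler_nat leq_fact // ltnS leq_double.
Qed.

Lemma high_gt0 k : 0 < high k.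
Proof. by rewrite ltr0n fact_gt0. Qed.

Lemma growth (D e : R) : 0 < D -> 0 < e -> exists k0, forall k, (k0 <= k)%N ->
  [/\ D * (k.+1)%:R <= e * low k, D * low k <= e * high k &
      D * high k <= e * low k.+1].
Proof.
move=> D0 e0; exists (Num.bound (D / e)).+1 => k le_k.
have Dk : D <= e * k%:R.
  rewrite mulrC -ler_pdivrMr //; apply: le_trans (_ : (Num.bound (D / e))%:R <= _).
    by rewrite ltW // archi_boundP // divr_ge0 // ltW.
  by rewrite ler_nat ltnW.
split.
- have h : k%:R * k.+1%:R <= low k.
    case: k le_k {Dk} => // k _; rewrite /low -natrM ler_nat doubleS !factS mulnA.
    by rewrite -[leqLHS]muln1 leq_mul ?fact_gt0 //; nia.
  have k0 : 0 <= k.+1%:R :> R by [].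
  nra.
- rewrite highE; have h := low_ge1 k.
  have h2 : k%:R <= k.*2.+1%:R :> R by rewrite ler_nat; lia.
  rewrite mulrA ler_wpM2r //.
  by rewrite (le_trans Dk) // ler_pM2l.
- rewrite lowS; have h := high_gt0 k.
  have h2 : k%:R <= k.*2.+2%:R :> R by rewrite ler_nat; lia.
  by rewrite mulrA ler_pM2r // (le_trans Dk) // ler_pM2l.
Qed.

End Growth.

Section Targets.
Variables (R : realType) (n : nat) (lam vp : R).
Hypothesis n_gt1 : (1 < n)%N.
Hypothesis vp_ge0 : 0 <= vp.
Hypothesis vp_le : vp * n%:R <= 1.
Hypothesis lam_ge : 1 <= vp + (n%:R - 1) * lam.
Hypothesis lam_le : (n%:R - 1) * vp + lam <= 1.

(* For [n = 2] the last branch, a division by 0, is not reached. *)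
Definition weight j : R :=
  if j == 1%N then lam else if j == n then vp else (1 - lam - vp) / (n%:R - 2).

Definition tau s : R :=
  let k := (s %/ n.+1)%N in let j := (s %% n.+1)%N in
  if j == 0%N then low R k else weight j * high R k.

Lemma nR_ge2 : 2 <= n%:R :> R.
Proof. by rewrite ler_nat. Qed.

Lemma vp_le_lam : vp <= lam.
Proof.
have n2 := nR_ge2; rewrite -subr_ge0 -(@pmulr_rge0 _ (n%:R - 1)); last by lra.
by have h1 := vp_le; have h2 := lam_ge; lra.
Qed.

(** After multiplication by [n - 2], [lam_ge] says that the common middle weight is at most [lam],
    and [lam_le] that it is at least [vp]. *)
Lemma weight_itv j : (0 < j <= n)%N -> vp <= weight j <= lam.
Proof.
move=> /andP[j0 le_jn]; rewrite /weight; have h := vp_le_lam; have h1 := lam_ge; have h2 := lam_le.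
case: eqP => [_|/eqP j1]; first by rewrite h lexx.
case: eqP => [_|/eqP jn]; first by rewrite h lexx.
have n3 : 3 <= n%:R :> R by rewrite ler_nat; lia.
by rewrite ler_pdivlMr ?ler_pdivrMr; [apply/andP; split; lra|lra|lra].
Qed.

Lemma lam_le1 : lam <= 1.
Proof.
have n2 := nR_ge2; have : 0 <= (n%:R - 1) * vp by rewrite mulr_ge0 //; lra.
by have h := lam_le; lra.
Qed.

Lemma lam_gt0 : 0 < lam.
Proof.
have n2 := nR_ge2; rewrite lt_def (le_trans vp_ge0 vp_le_lam) andbT.
apply/eqP => lam0; have := vp_le_lam; have := lam_ge; have := vp_ge0; rewrite lam0; lra.
Qed.

Lemma weight_sum : \sum_(i < n) weight i.+1 = 1.
Proof.
have e : n = n.-2.+2 by lia.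
rewrite -(big_mkord xpredT (fun i => weight i.+1)) e big_nat_recl // big_nat_recr //=.
rewrite -e /weight eqxx /= ifN ?eqxx; last by lia.
under eq_big_nat => i /andP[_ lt_i].
  rewrite ifN; last by lia.
over.
rewrite sumr_const_nat subn0.
(* For [n = 2] there is no middle weight, and the two inequalities force [lam + vp = 1]. *)
have [n2|n3] := eqVneq n 2%N.
  by have := lam_ge; have := lam_le; rewrite n2 /= mulr0n add0r; lra.
have -> : n%:R - 2 = n.-2%:R :> R by rewrite -subn2 natrB.
rewrite -(mulr_natr (_ / _)) divfK; first by lra.
by rewrite pnatr_eq0; lia.
Qed.

Lemma tau_low k : tau (k * n.+1) = low R k.
Proof. by rewrite /tau modnMl mulnK. Qed.

Lemma tau_high k j : (0 < j <= n)%N -> tau (k * n.+1 + j) = weight j * high R k.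
Proof.
move=> /andP[j0 le_jn].
by rewrite /tau modnMDl divnMDl // modn_small // divn_small // addn0 gtn_eqF.
Qed.

Lemma tau_le_high k s : (s <= k * n.+1 + n)%N -> tau s <= high R k.
Proof.
move=> le_s; have := divn_eq s n.+1; have := ltn_pmod s (ltn0Sn n); rewrite /tau.
set q := (s %/ _)%N; set j := (s %% _)%N => lt_j e.
have le_q : (q <= k)%N by rewrite -ltnS /q ltn_divLR //; nia.
apply: le_trans (high_mono R le_q).
case: eqP => [_|/eqP j0]; first exact: low_le_high.
have /andP[_ h] : vp <= weight j <= lam by apply: weight_itv; lia.
by rewrite ler_piMl ?(ltW (high_gt0 _ _)) // (le_trans h lam_le1).
Qed.

Lemma tau_le_low k s : (s <= k * n.+1)%N -> tau s <= low R k.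
Proof.
rewrite leq_eqVlt => /predU1P[->|lt_s]; first by rewrite tau_low.
case: k lt_s => [//|k] lt_s.
by apply: le_trans (high_le_low R k); apply: tau_le_high; lia.
Qed.

End Targets.

(** * Expansions *)

Definition intmx (R : realType) (m : nat) (v : 'rV[int]_m) : 'rV[R]_m := map_mx intr v.

(** Kept as a relation, so that two runs with different bits but the same [theta] can be compared in
    [expansion_inj]. *)
Record expansion (R : realType) (n : nat) (tau : nat -> R) (b : nat -> bool)
    (theta : 'rV[R]_n) (A : nat -> nat) (Y F : nat -> 'rV[int]_(1 + n)) : Prop :=
  Expansion {
    expansion_scale : is_scale n tau b A;
    expansion_point : point_rec n (fun t => coef n tau b t (A t) (A t.+1)) Y;
    expansion_form : form_rec n (fun t => coef n tau b t (A t) (A t.+1)) F;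
    expansion_point_init : forall j, (j <= n)%N ->
      Y j = delta_mx 0 (inord (if j == n then 0%N else j.+1));
    expansion_form_init : forall i, (i <= n)%N -> F i = delta_mx 0 (inord i);
    expansion_approx : forall t i,
      `|(Y t 0 i)%:~R - (Y t 0 0)%:~R * homog theta 0 i| <= 2 ^+ t / (A t.+1)%:R }.

Section Expansion.
Variables (R : realType) (n : nat) (tau : nat -> R).
Hypothesis n_gt1 : (1 < n)%N.

Lemma expansion_exists b :
  exists theta A Y F, @expansion R n tau b theta A Y F.
Proof.
have [A scaleA] := scale_exists tau b n_gt1.
pose c t := coef n tau b t (A t) (A t.+1).
have [Y [Y_init Y_rec]] := window_rec
  (fun j => delta_mx 0 (inord (if j == n then 0%N else j.+1)) : 'rV[int]_(1 + n))
  (fun t y0 _ yn => yn *+ c t + y0) (ltnW n_gt1).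
have [F [F_init F_rec]] := window_rec
  (fun i => delta_mx 0 (inord i) : 'rV[int]_(1 + n))
  (fun t f0 f1 _ => f0 - f1 *+ c t) (ltnW n_gt1).
have [theta approx] := @theta_exists n c A n_gt1 scaleA.1 scaleA.2
  (is_scale_grow n_gt1 scaleA) Y Y_rec Y_init R.
by exists theta, A, Y, F; split.
Qed.

(* The values f_t = F_t . u are positive, decrease and satisfy
   f_t = c_t f_(t+1) + f_(t+n+1), so c_t is the integer part of f_t / f_(t+1). *)
Lemma expansion_inj b b' theta A A' Y Y' F F' :
  @expansion R n tau b theta A Y F -> @expansion R n tau b' theta A' Y' F' -> b = b'.
Proof.
move=> X X'.
pose c t := coef n tau b t (A t) (A t.+1).
pose c' t := coef n tau b' t (A' t) (A' t.+1).
pose f t := dot (intmx R (F t)) (homog theta).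
pose f' t := dot (intmx R (F' t)) (homog theta).
have scaleA := expansion_scale X; have scaleA' := expansion_scale X'.
have c1 t : (1 < c t)%N by exact: coef_gt1.
have c1' t : (1 < c' t)%N by exact: coef_gt1.
have f0 t : 0 < f t.
  exact: (form_value_gt0 n_gt1 scaleA.1 scaleA.2 (is_scale_grow n_gt1 scaleA) c1
    (expansion_point X) (expansion_form X) (expansion_point_init X)
    (expansion_form_init X) (expansion_approx X)).
have f0' t : 0 < f' t.
  exact: (form_value_gt0 n_gt1 scaleA'.1 scaleA'.2 (is_scale_grow n_gt1 scaleA') c1'
    (expansion_point X') (expansion_form X') (expansion_point_init X')
    (expansion_form_init X') (expansion_approx X')).
have rf : form_rec n c f := form_value_rec (expansion_form X) _.
have rf' : form_rec n c' f' := form_value_rec (expansion_form X') _.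
have decr (g : nat -> R) d s t : (forall t, 0 < g t) -> (forall t, (1 < d t)%N) ->
    form_rec n d g -> (s < t)%N -> g t < g s :> R.
  move=> g0 d1 rg.
  have step k : g k.+1 < g k.
    have := g0 (k + n).+1; rewrite rg subr_gt0; apply: le_lt_trans.
    rewrite -(mulr_natr (g _)) ler_peMr ?(ltW (g0 _)) // ler1n.
    exact: ltnW.
  elim: t => // t IH; rewrite ltnS leq_eqVlt => /predU1P[->//|/IH].
  exact: lt_trans.
have quot (g : nat -> R) d t : (forall t, 0 < g t) -> (forall t, (1 < d t)%N) ->
    form_rec n d g -> (d t)%:R * g t.+1 < g t < (d t).+1%:R * g t.+1.
  move=> g0 d1 rg; have := g0 (t + n).+1.
  have : g (t + n).+1 < g t.+1 by apply: decr g0 d1 rg _; lia.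
  rewrite rg -(mulr_natr (g _)) -natr1 => h1 h2; apply/andP; split; lra.
have bE t : A t = A' t -> A t.+1 = A' t.+1 -> F t = F' t -> F t.+1 = F' t.+1 ->
    b t = b' t.
  move=> eA eA1 eF eF1.
  have := quot f' c' t f0' c1' rf'; have := quot f c t f0 c1 rf.
  have -> : f' t = f t by rewrite /f /f' eF.
  have -> : f' t.+1 = f t.+1 by rewrite /f /f' eF1.
  move=> /andP[h1 h2] /andP[h3 h4].
  have := lt_trans h1 h4; have := lt_trans h3 h2.
  rewrite !ltr_pM2r // !ltr_nat /c /c' /coef eA eA1.
  by case: (b t); case: (b' t) => //; lia.
(* [A] and [F] have to be recovered together: a coefficient reveals its bit only once the scales
   entering [coef] are known to agree. *)
have AF t : A t = A' t /\ F t = F' t.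
  elim/(@window_ind n): t => [i le_in|t IH].
    rewrite (expansion_form_init X) // (expansion_form_init X') //.
    by rewrite scaleA.1 // scaleA'.1.
  have [eA eF] := IH t (leq_addr _ _).
  have [eA1 eF1] : A t.+1 = A' t.+1 /\ F t.+1 = F' t.+1 by apply: IH; lia.
  have cE : c t = c' t by rewrite /c /c' /coef eA eA1 (bE t).
  rewrite scaleA.2 scaleA'.2 (expansion_form X) (expansion_form X').
  by rewrite -/(c t) -/(c' t) cE eA1 eF eF1.
apply/funext => t; have [eA eF] := AF t; have [eA1 eF1] := AF t.+1.
exact: bE.
Qed.

End Expansion.

Lemma exp2_le_expR (R : realType) (t : nat) : 2 ^+ t <= expR (t%:R : R).
Proof.
rewrite -[t%:R]mulr1 mulrC expRM_natr lerXn2r ?nnegrE ?expR_ge0 //.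
by rewrite (le_trans _ (expR_ge1Dx 1)).
Qed.

Lemma natr_le_expR (R : realType) (t : nat) : t.+1%:R <= expR (t%:R : R).
Proof. by rewrite -natr1 addrC expR_ge1Dx. Qed.

(** Integer version of approximation by a hyperplane: [x] stands for the height and [y] for height
    times distance, up to constants that do not affect the exponents. [point_approx] does the same
    for rational points. *)
Definition form_approx (R : realType) (n : nat) (theta : 'rV[R]_n) (x y : R) : Prop :=
  exists f : 'rV[int]_(1 + n), [/\ f != 0, forall i, `|(f 0 i)%:~R| <= x &
    `|dot (intmx R f) (homog theta)| <= y].

Definition point_approx (R : realType) (n : nat) (theta : 'rV[R]_n) (x y : R) : Prop :=
  exists p : 'rV[int]_(1 + n), [/\ p 0 0 != 0, `|(p 0 0)%:~R| <= x &
    forall i, `|(p 0 i)%:~R - (p 0 0)%:~R * homog theta 0 i| <= y].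

(** * Sizes, values and errors in each period of the profile *)

Section Bounds.
Variables (R : realType) (n : nat) (lam vp : R).
Hypothesis n_gt1 : (1 < n)%N.
Hypothesis vp_ge0 : 0 <= vp.
Hypothesis vp_le : vp * n%:R <= 1.
Hypothesis lam_ge : 1 <= vp + (n%:R - 1) * lam.
Hypothesis lam_le : (n%:R - 1) * vp + lam <= 1.
Variables (b : nat -> bool) (theta : 'rV[R]_n).
Variables (A : nat -> nat) (Y F : nat -> 'rV[int]_(1 + n)).
Let tau := tau n lam vp.
Hypothesis X : expansion tau b theta A Y F.
Let c t := coef n tau b t (A t) (A t.+1).
Let u := homog theta.
Let N t : R := (Y t 0 0)%:~R.
Let K := scale_loss R n.
Let wt := weight n lam vp.

Let scaleA : is_scale n tau b A := expansion_scale X.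
Let A_grow := is_scale_grow n_gt1 scaleA.
Let c_gt1 t : (1 < c t)%N.
Proof. exact: coef_gt1. Qed.

Let N_rec : point_rec n c N := denom_rec (expansion_point X) R.
Let N_mono s t : (s <= t)%N -> N s <= N t.
Proof.
exact: (denom_mono scaleA.1 scaleA.2 A_grow (expansion_point X)
  (expansion_point_init X) R).
Qed.
Let N_gt0 t : (n <= t)%N -> 0 < N t.
Proof.
exact: (denom_pos scaleA.1 scaleA.2 A_grow (expansion_point X)
  (expansion_point_init X) R).
Qed.

Let A_gt0 t : 0 < (A t)%:R :> R.
Proof. by rewrite ltr0n (is_scale_gt0 n_gt1 scaleA). Qed.

Definition window t : R := \prod_(j < n) (A (t + j).+1)%:R.

Lemma window_rec_prod t : window t.+1 = (c t)%:R * window t.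
Proof.
rewrite /window; have e : n = n.-1.+1 by lia.
rewrite e big_ord_recr big_ord_recl /= addn0 mulrA mulrC.
have -> : (t.+1 + n.-1).+1 = (t + n).+1 by lia.
rewrite scaleA.2 natrM; congr (_ * _).
by apply: eq_bigr => i _; rewrite /bump /= add1n addnS addSn.
Qed.

(** One step multiplies [window] by exactly [c t], and the denominator by a factor between [c t] and
    [2 * c t], because [N t <= N (t + n)]. *)
Lemma denom_window t : window t <= N (t + n)%N <= 2 ^+ t * window t.
Proof.
elim: t => [|t /andP[IH1 IH2]].
  rewrite /window big1 => [|i _]; last by rewrite scaleA.1 // ltn_ord.
  by rewrite /N add0n (denom_n (expansion_point_init X)) mulr1 lexx.
rewrite window_rec_prod addSn N_rec -(mulr_natr (N _)).
have h0 : 0 <= N t.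
  exact: (denom_nneg scaleA.1 scaleA.2 A_grow (expansion_point X)
    (expansion_point_init X) R).
have h1 : N t <= N (t + n)%N by apply: N_mono; rewrite leq_addr.
have h2 : 1 <= (c t)%:R :> R by rewrite ler1n ltnW.
apply/andP; split.
  by rewrite -[leLHS]addr0 lerD // mulrC ler_wpM2r // (le_trans ler01).
rewrite exprS -mulrA [2 ^+ t * _]mulrCA.
have h3 : 0 <= N (t + n)%N by rewrite (le_trans h0).
set z := 2 ^+ t * _ in IH2 *; nra.
Qed.

Let w k : R := (n.+1 * k.+1)%:R.
(* Absorbs all the factors exp(O(t)) of the k-th period. *)
Let slack k : R := (n.*2 + 10)%:R * (K + 1) * w k.

Let K_ge0 : 0 <= K := scale_loss_ge0 R n.
Let w_ge0 k : 0 <= w k.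
Proof. by []. Qed.

Let slackE k : slack k = 2 * (n%:R * ((K + 1) * w k)) + 10 * ((K + 1) * w k).
Proof. by rewrite /slack natrD -mul2n natrM; ring. Qed.

Let slack_facts k : [/\ K * w k = (K + 1) * w k - w k, 0 <= K * w k,
  (K + 1) * w k <= n%:R * ((K + 1) * w k) & 0 <= n%:R * w k <= n%:R * ((K + 1) * w k)].
Proof.
have h0 : 0 <= (K + 1) * w k by rewrite mulr_ge0 // addr_ge0.
split; first by ring.
- by rewrite mulr_ge0.
- by rewrite ler_peMl // ler1n ltnW.
- rewrite mulr_ge0 //= ler_wpM2l // ler_peMl // lerDr //.
Qed.

Let wt_itv j : (0 < j <= n)%N -> vp <= wt j <= lam.
Proof. exact: weight_itv. Qed.

Let wt_sum : \sum_(j < n) wt j.+1 = 1.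
Proof. exact: weight_sum. Qed.

Let low_gt0 k : 0 < low R k. Proof. exact: lt_le_trans (low_ge1 R k). Qed.

Lemma scale_le_low k s : (s <= k * n.+1)%N -> (A s)%:R <= expR (low R k + K * w k).
Proof.
move=> le_s; apply: le_trans (is_scale_crude n_gt1 scaleA (ltW (low_gt0 k)) _) _.
  by move=> i le_is; apply: tau_le_low => //; lia.
by rewrite ler_expR lerD2l ler_wpM2l // ler_nat; nia.
Qed.

Lemma scale_le_high k s : (s <= k * n.+1 + n)%N ->
  (A s)%:R <= expR (high R k + K * w k).
Proof.
move=> le_s; apply: le_trans (is_scale_crude n_gt1 scaleA (ltW (high_gt0 R k)) _) _.
  by move=> i le_is; apply: tau_le_high => //; lia.
by rewrite ler_expR lerD2l ler_wpM2l // ler_nat; nia.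
Qed.

(** The two earlier scales entering this one have index at most [k * n.+1], so they are at most
    about [expR (low R k)]. Hence the extra [low R k], negligible against [high R k] but dominant
    when the weight is 0. *)
Lemma scale_le_weight k j : (0 < k)%N -> (0 < j <= n)%N ->
  (A (k * n.+1 + j)%N)%:R <= expR (wt j * high R k + low R k + K * w k).
Proof.
case: k => // k _ j_itv; pose t := (k * n.+1 + j)%N.
have e : (k.+1 * n.+1 + j)%N = (t + n).+1 by rewrite /t; lia.
have /andP[wt0 _] := wt_itv j_itv.
have wh0 : 0 <= wt j * high R k.+1.
  by rewrite mulr_ge0 ?(ltW (high_gt0 _ _)) // (le_trans vp_ge0).
have crude s : (s <= k.+1 * n.+1)%N ->
    (A s)%:R <= expR (wt j * high R k.+1 + low R k.+1 + K * (k.+1 * n.+1)%:R).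
  move=> le_s; apply: le_trans (is_scale_crude n_gt1 scaleA (ltW (low_gt0 k.+1)) _) _.
    by move=> i le_is; apply: tau_le_low => //; exact: leq_trans le_is le_s.
  rewrite ler_expR lerD ?ler_wpM2l ?ler_nat // lerDr //.
have le_t : (t < k.+1 * n.+1)%N by rewrite /t; case/andP: j_itv => *; lia.
rewrite e; apply: le_trans (is_scale_exp_ub n_gt1 scaleA _ (crude t (ltnW le_t)) (crude t.+1 le_t)) _.
  rewrite -e /tau tau_high // -/wt -addrA lerDl addr_ge0 ?(ltW (low_gt0 _)) //.
  by rewrite mulr_ge0.
rewrite ler_expR addrC -addrA lerD2l -/K -[X in _ + X]mulr1 -mulrDr ler_wpM2l //.
by rewrite natr1 ler_nat; nia.
Qed.

Lemma scale_ge_tau s : (n < s)%N -> expR (tau s) <= (A s)%:R.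
Proof. move=> lt_ns; exact: (is_scale_exp_lb n_gt1 scaleA lt_ns). Qed.

Let exp2_le t (x : R) : t%:R <= x -> 2 ^+ t <= expR x.
Proof. by move=> h; rewrite (le_trans (exp2_le_expR R t)) // ler_expR. Qed.

Lemma form_le_low k i : `|(F (k * n.+1)%N 0 i)%:~R : R| <= expR (low R k + slack k).
Proof.
rewrite (le_trans (form_bound n_gt1 scaleA.1 scaleA.2 A_grow (expansion_form X)
  (expansion_form_init X) R _ _)) //.
apply: (@le_trans _ _ (expR (w k) * expR (low R k + K * w k))).
  by rewrite ler_pM ?exprn_ge0 ?scale_le_low // exp2_le // ler_nat; nia.
rewrite -expRD ler_expR slackE; have [h1 h2 h3 /andP[h4 h5]] := slack_facts k.
have := w_ge0 k; lra.
Qed.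

Lemma form_le_weight k j i : (0 < k)%N -> (0 < j <= n)%N ->
  `|(F (k * n.+1 + j)%N 0 i)%:~R : R| <= expR (wt j * high R k + low R k + slack k).
Proof.
move=> k0 j_itv.
rewrite (le_trans (form_bound n_gt1 scaleA.1 scaleA.2 A_grow (expansion_form X)
  (expansion_form_init X) R _ _)) //.
apply: (@le_trans _ _ (expR (w k) * expR (wt j * high R k + low R k + K * w k))).
  rewrite ler_pM ?exprn_ge0 ?scale_le_weight // exp2_le // ler_nat.
  by case/andP: j_itv => _; nia.
rewrite -expRD ler_expR slackE; have [h1 h2 h3 /andP[h4 h5]] := slack_facts k.
have := w_ge0 k; lra.
Qed.

Lemma form_value_le k t : (0 < k)%N -> (t <= k * n.+1 + n)%N ->
  `|dot (intmx R (F t)) u| <= expR (slack k) / N (t + n)%N.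
Proof.
move=> k0 le_t.
rewrite (le_trans (form_value_bound n_gt1 scaleA.1 scaleA.2 A_grow
  (expansion_point X) (expansion_form X) (expansion_point_init X)
  (expansion_form_init X) (expansion_approx X) _)) //.
rewrite ler_wpM2r ?invr_ge0 ?(ltW (N_gt0 _)) ?leq_addl //.
have -> : 4 = 2 ^+ 2 :> R by rewrite expr2 -natrM.
rewrite -exprM.
apply: (@le_trans _ _ (n.+2%:R * 2 ^+ (2 * (t + n)))).
  rewrite -[n.+2%:R]natr1 addrC mulrDl mul1r add1n lerD2l.
  by rewrite exprn_ege1 // ler1n.
apply: (@le_trans _ _ (expR n.+1%:R * expR (2 * (t + n))%:R)).
  by rewrite ler_pM ?exprn_ge0 ?natr_le_expR ?exp2_le_expR.
rewrite -expRD ler_expR slackE; have [h1 h2 h3 /andP[h4 h5]] := slack_facts k.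
have h6 : n.+1%:R + (2 * (t + n))%:R <= 5 * w k.
  by rewrite -natrD -natrM ler_nat; nia.
have := w_ge0 k; lra.
Qed.

(** The window after the low index carries every weight once, and the weights sum to 1. The first
    period is excluded because its scales are all 1. *)
Lemma denom_ge_high k : (0 < k)%N -> expR (high R k) <= N (k * n.+1 + n)%N.
Proof.
move=> k0; have /andP[h _] := denom_window (k * n.+1); apply: le_trans h.
rewrite -[high R k]mul1r -wt_sum mulr_suml expR_sum.
apply: ler_prod => j _; rewrite expR_ge0 /= -addnS.
apply: le_trans (scale_ge_tau _); last by nia.
by rewrite /tau tau_high //= ltn_ord.
Qed.

(** Of this window only the factor carrying [lam], at position 1 of the next period, is kept; the
    other factors are at least 1. *)
Lemma denom_ge_lam k : expR (lam * high R k.+1) <= N (k * n.+1 + n + n)%N.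
Proof.
have /andP[h _] := denom_window (k * n.+1 + n); apply: le_trans h.
rewrite /window (bigD1 (Ordinal n_gt1)) //=.
have -> : (k * n.+1 + n + 1).+1 = (k.+1 * n.+1 + 1)%N by lia.
have e : expR (lam * high R k.+1) <= (A (k.+1 * n.+1 + 1)%N)%:R.
  apply: le_trans (scale_ge_tau _); last by lia.
  by rewrite /tau tau_high ?(ltnW n_gt1) // /weight eqxx.
apply: le_trans e _; rewrite ler_peMr //.
elim/big_ind: _ => // [x y x1 y1|j _]; last by rewrite ler1n (is_scale_gt0 n_gt1 scaleA).
by rewrite -[1]mulr1 ler_pM.
Qed.

Lemma denom_le_high k : (0 < k)%N ->
  N (k * n.+1 + n)%N <= expR (high R k + n%:R * low R k + slack k).
Proof.
move=> k0; have /andP[_ h] := denom_window (k * n.+1); apply: le_trans h _.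
apply: (@le_trans _ _ (expR (w k) *
    \prod_(j < n) expR (wt j.+1 * high R k + (low R k + K * w k)))).
  rewrite ler_pM ?exprn_ge0 ?prodr_ge0 //; first by apply: exp2_le; rewrite ler_nat; nia.
  by apply: ler_prod => j _; rewrite ler0n addrA -addnS scale_le_weight //=.
rewrite -expR_sum -expRD ler_expR big_split /= -mulr_suml.
rewrite wt_sum mul1r sumr_const card_ord -(mulr_natl (_ + _)).
rewrite slackE; have [h1 h2 h3 /andP[h4 h5]] := slack_facts k.
rewrite mulrDr h1 mulrBr; have := w_ge0 k; lra.
Qed.

(** This window ends at the low index of period [k.+1]. Its other [n.-1] factors belong to period
    [k], and each costs at most [high R k] up to slack. *)
Lemma denom_le_low k : N (k.+1 * n.+1)%N <= expR (low R k.+1 + n%:R * high R k + slack k).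
Proof.
have /andP[_] := denom_window (k * n.+1).+1.
have -> : ((k * n.+1).+1 + n = k.+1 * n.+1)%N by lia.
move=> h; apply: le_trans h _.
apply: (@le_trans _ _ (expR (w k) * (expR ((high R k + K * w k) *+ n.-1) *
    expR (low R k.+1 + K * w k.+1)))).
  rewrite ler_pM ?exprn_ge0 ?prodr_ge0 //; first by apply: exp2_le; rewrite ler_nat; nia.
  rewrite /window; have en : n = n.-1.+1 by lia.
  rewrite [in leLHS]en big_ord_recr /= ler_pM ?prodr_ge0 //; last first.
    by apply: scale_le_low; lia.
  rewrite -[X in _ *+ X]card_ord -sumr_const expR_sum; apply: ler_prod => j _.
  by rewrite ler0n /= scale_le_high //; have := ltn_ord j; lia.
rewrite -!expRD ler_expR slackE; have [h1 h2 h3 /andP[h4 h5]] := slack_facts k.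
have h6 : w k.+1 <= 2 * w k by rewrite -natrM ler_nat; nia.
have h7 : K * w k.+1 <= 2 * (K * w k) by rewrite mulrCA ler_wpM2l.
have h8 : (high R k + K * w k) *+ n.-1 <= n%:R * (high R k + K * w k).
  rewrite -(mulr_natl (_ + _) n.-1) ler_wpM2r ?ler_nat ?leq_pred // addr_ge0 //.
rewrite mulrDr {2}h1 mulrBr in h8; have := w_ge0 k; lra.
Qed.

Lemma error_le k t i : (n <= t)%N -> (t <= k * n.+1 + n)%N ->
  `|(Y t 0 i)%:~R - N t * u 0 i| <= expR (slack k - tau t.+1).
Proof.
move=> le_nt le_t; rewrite (le_trans (expansion_approx X _ _)) // expRB.
rewrite ler_pM ?exprn_ge0 ?invr_ge0 //.
  apply: exp2_le; apply: (@le_trans _ _ (w k)); first by rewrite ler_nat; nia.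
  rewrite slackE; have [h1 h2 h3 /andP[h4 h5]] := slack_facts k.
  have := w_ge0 k; lra.
by rewrite lef_pV2 ?posrE ?expR_gt0 // scale_ge_tau.
Qed.

Lemma slack_growth e : 0 < e -> exists k0, forall k, (k0 <= k)%N ->
  [/\ (0 < k)%N, slack k <= e * low R k, n%:R * low R k <= e * high R k &
      n%:R * high R k <= e * low R k.+1].
Proof.
move=> e0; pose D := (n.*2 + 10)%:R * (K + 1) * n.+1%:R : R.
have Dn : n%:R <= D.
  rewrite /D -mulrA mulrCA -natrM -[leLHS]mul1r ler_pM //; first by rewrite lerDr.
  by rewrite ler_nat; nia.
have n0 : 0 < n%:R :> R by rewrite ltr0n ltnW.
have [k0 Hk] := growth (lt_le_trans n0 Dn) e0; exists k0.+1 => k lt_k.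
have [h1 h2 h3] := Hk k (ltnW lt_k); split; first exact: leq_ltn_trans lt_k.
- by rewrite (le_trans _ h1) // /slack /D /w natrM mulrA.
- by rewrite (le_trans _ h2) // ler_wpM2r // (ltW (low_gt0 _)).
- by rewrite (le_trans _ h3) // ler_wpM2r // (ltW (high_gt0 _ _)).
Qed.

Lemma int_eq0 (z : int) : `|z%:~R| < 1 :> R -> z = 0.
Proof. by rewrite -intr_norm -[1]/(1%:~R) ltr_int; lia. Qed.

Lemma dot_shift (x y : 'rV[int]_(1 + n)) : (dot x y)%:~R =
  dot (intmx R x) (intmx R y - (y 0 0)%:~R *: u) + (y 0 0)%:~R * dot (intmx R x) u.
Proof. by rewrite dotDr dotNr dotZr -addrA addNr addr0 dot_intr. Qed.

(** The last two parts are the obstructions. A nonzero integer vector cannot be orthogonal to a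
    whole window, so one of the pairings has absolute value at least 1; [dot_shift] bounds that
    pairing by the two terms shown. *)
Lemma stage_bounds e : 0 < e -> exists k0, forall k, (k0 <= k)%N ->
  [/\ form_approx theta (expR (e * high R k)) (expR (- ((1 - e) * high R k))) /\
      form_approx theta (expR ((vp + e) * high R k)) (expR (- ((lam - e) * high R k.+1))),
      point_approx theta (expR ((1 + e) * low R k.+1)) (expR (- ((lam - e) * high R k.+1))) /\
      point_approx theta (expR ((1 + e) * high R k)) (expR (- ((1 - e) * low R k.+1))),
      forall x y, form_approx theta x y ->
        1 <= (1 + n)%:R * (x * expR (- ((vp - e) * high R k))) +
             expR ((1 + e) * high R k) * y &
      forall x y, point_approx theta x y ->
        1 <= (1 + n)%:R * (expR ((lam + e) * high R k) * y) +
             x * expR (- ((1 - e) * high R k))].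
Proof.
(* A quarter of [e], so that several error terms, each at most [e'] times a main term, still fit
   into [e]. *)
move=> e0; pose e' := e / 4; have e'0 : 0 < e' by rewrite divr_gt0.
have e4 : e = 4 * e' by rewrite /e' mulrC divfK.
have [k0 Hk0] := slack_growth e'0; exists k0 => k le_k.
have [k_gt0 g1 g2 g3] := Hk0 k le_k; have [_ g4 g5 g6] := Hk0 k.+1 (leqW le_k).
have kn : (n <= k * n.+1)%N by rewrite (leq_trans (leqnSn n)) // leq_pmull.
have kSn : (k * n.+1 + n).+1 = (k.+1 * n.+1)%N by rewrite -addnS mulSn addnC.
have n_kS : (n <= k.+1 * n.+1)%N by rewrite -kSn leqW // leq_addl.
have n2 : 2 <= n%:R :> R by rewrite ler_nat.
have l0 := low_gt0 k; have l1 := low_gt0 k.+1.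
have h0 := high_gt0 R k; have h1 := high_gt0 R k.+1.
have lh := low_le_high R k; have hl := high_le_low R k; have lh1 := low_le_high R k.+1.
have f1 : 2 * low R k <= n%:R * low R k by rewrite ler_pM2r.
have f2 : 2 * high R k <= n%:R * high R k by rewrite ler_pM2r.
have f3 : 2 * low R k.+1 <= n%:R * low R k.+1 by rewrite ler_pM2r.
have f4 : e' * low R k <= e' * high R k by rewrite ler_pM2l.
have f5 : e' * high R k <= e' * low R k.+1 by rewrite ler_pM2l.
have f6 : e' * low R k.+1 <= e' * high R k.+1 by rewrite ler_pM2l.
have f7 : 0 < e' * low R k by rewrite mulr_gt0.
have s0 : 0 <= slack k by rewrite !mulr_ge0 // addr_ge0.
have lam0 : 0 < lam by exact: (lam_gt0 n_gt1 vp_ge0 vp_le lam_ge).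
have Fn0 t : F t != 0.
  apply/eqP => Ft0; have := dot_form_last n_gt1 (expansion_point X) (expansion_form X)
    (expansion_point_init X) (expansion_form_init X) t.
  by rewrite Ft0 /dot big1 // => i _; rewrite mxE mul0r.
have value t y : (t <= k * n.+1 + n)%N -> expR y <= N (t + n)%N ->
    `|dot (intmx R (F t)) u| <= expR (slack k - y).
  move=> le_t hN; rewrite (le_trans (form_value_le k_gt0 le_t)) // expRB.
  by rewrite ler_wpM2l ?expR_ge0 // lef_pV2 // posrE ?expR_gt0 ?N_gt0 ?leq_addl.
have FB j i : (j <= n)%N ->
    `|(F (k * n.+1 + j)%N 0 i)%:~R : R| <= expR ((lam + e) * high R k).
  move=> le_jn; have la0 : 0 < lam * high R k by rewrite mulr_gt0 ?lam0.
  have [->|j0] := posnP j.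
    by rewrite addn0 (le_trans (form_le_low _ _)) // ler_expR mulrDl e4; lra.
  rewrite (le_trans (form_le_weight _ k_gt0 _)) ?j0 // ler_expR mulrDl e4.
  have /andP[_] : vp <= wt j <= lam by apply: wt_itv; rewrite j0.
  by rewrite -(ler_pM2r h0); lra.
have VB j : (j <= n)%N ->
    `|dot (intmx R (F (k * n.+1 + j)%N)) u| <= expR (- ((1 - e) * high R k)).
  move=> le_jn; rewrite (le_trans (value _ (high R k) _ _)) ?leq_add2l //.
    rewrite (le_trans (denom_ge_high k_gt0)) // N_mono //.
    by rewrite leq_add2r leq_addr.
  by rewrite ler_expR e4; lra.
have NB : N (k * n.+1 + n)%N <= expR ((1 + e) * high R k).
  by rewrite (le_trans (denom_le_high k_gt0)) // ler_expR e4; lra.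
split.
- split.
    (* Its size sees only the low scale, its value the whole window of weights. *)
    exists (F (k * n.+1)%N); split=> // [i|].
      by rewrite (le_trans (form_le_low _ _)) // ler_expR e4; lra.
    by have := VB 0%N isT; rewrite addn0.
  (* Its size carries the smallest weight, and its value already profits from the next period. *)
  exists (F (k * n.+1 + n)%N); split=> // [i|].
    rewrite (le_trans (form_le_weight _ k_gt0 _)) ?leqnn ?(ltnW n_gt1) // ler_expR e4.
    by rewrite /wt /weight gtn_eqF // eqxx; lra.
  rewrite (le_trans (value _ _ (leqnn _) (denom_ge_lam k))) // ler_expR e4; lra.
- split.
    (* The next scale after this low index carries the weight [lam], which governs the error. *)
    exists (Y (k.+1 * n.+1)%N); rewrite -(intr_eq0 R) gt_eqF ?(N_gt0 n_kS) //.
    split=> // [|i].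
      rewrite ger0_norm ?(ltW (N_gt0 n_kS)) //.
      by rewrite (le_trans (denom_le_low k)) // ler_expR e4; lra.
    rewrite (le_trans (@error_le k.+1 _ _ _ _)) ?leq_addr //.
    have -> : (k.+1 * n.+1).+1 = (k.+1 * n.+1 + 1)%N by rewrite addn1.
    by rewrite /tau tau_high ?(ltnW n_gt1) // /weight eqxx ler_expR e4; lra.
  (* The next index is the low one of period [k.+1], whence an error of about
     [expR (- low R k.+1)]. *)
  exists (Y (k * n.+1 + n)%N); rewrite -(intr_eq0 R) gt_eqF ?(N_gt0 (leq_addl _ _)) //.
  split=> // [|i]; first by rewrite ger0_norm ?(ltW (N_gt0 (leq_addl _ _))).
  rewrite (le_trans (@error_le k _ _ _ _)) ?leq_addl //.
  by rewrite kSn /tau tau_low ler_expR e4; lra.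
- move=> x y [f [f0 fx fy]]; rewrite leNgt; apply/negP => lt1; move/eqP: f0; apply.
  apply: (points_separate n_gt1 (expansion_point X) (expansion_point_init X)
    (t := (k * n.+1)%N)) => j le_jn.
  apply: int_eq0; rewrite dot_shift; apply: le_lt_trans lt1.
  rewrite (le_trans (ler_normD _ _)) // lerD //.
    apply: dot_norm_le => i; [by rewrite mxE fx|rewrite row_subZE mxE].
    rewrite (le_trans (@error_le k _ _ _ _)) ?leq_add2l // ?(leq_trans kn) ?leq_addr //.
    rewrite ler_expR; have vh : vp * high R k <= tau (k * n.+1 + j).+1.
      (* The last point of the window is the exception: its error is governed by [low R k.+1], which
         is at least [high R k]. *)
      move: le_jn; rewrite leq_eqVlt => /predU1P[->|lt_jn].
        rewrite kSn /tau tau_low (le_trans _ hl) // ler_piMl ?(ltW h0) //.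
        apply: (@le_trans _ _ lam).
          exact: (vp_le_lam n_gt1 vp_le lam_ge).
        exact: (lam_le1 n_gt1 vp_ge0 lam_le).
      rewrite -addnS /tau tau_high // ler_pM2r //.
      by have /andP[] := wt_itv (j := j.+1) lt_jn.
    by rewrite e4; lra.
  rewrite normrM ler_pM //.
  rewrite (le_trans _ NB) // ger0_norm; first by rewrite N_mono // leq_add2l.
  exact: (denom_nneg scaleA.1 scaleA.2 A_grow (expansion_point X)
    (expansion_point_init X) R).
move=> x y [p [p0 px py]]; rewrite leNgt; apply/negP => lt1.
suff e00 : p = 0 by move: p0; rewrite e00 mxE eqxx.
apply: (forms_separate (expansion_form X) (expansion_form_init X)
    (t := (k * n.+1)%N)) => j le_jn.
apply: int_eq0; rewrite dot_shift; apply: le_lt_trans lt1.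
rewrite (le_trans (ler_normD _ _)) // lerD //.
  apply: dot_norm_le => i; first by rewrite mxE; exact: FB.
  by rewrite row_subZE mxE; exact: py.
by rewrite normrM ler_pM // VB.
Qed.

End Bounds.

(** * Heights of points and hyperplanes *)

Section EuclideanNorm.
Variables (R : realType) (m : nat).
Implicit Types v : 'rV[R]_m.

Lemma enorm_ge0 v : 0 <= enorm v.
Proof. exact: sqrtr_ge0. Qed.

Lemma sumsq_ge0 v : 0 <= \sum_i v 0 i ^+ 2.
Proof. by apply: sumr_ge0 => i _; exact: sqr_ge0. Qed.

Lemma coord_le_enorm v i : `|v 0 i| <= enorm v.
Proof.
rewrite -sqrtr_sqr /enorm ler_wsqrtr // (bigD1 i) //= lerDl.
by apply: sumr_ge0 => j _; exact: sqr_ge0.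
Qed.

Lemma enorm_le_sum v : enorm v <= \sum_i `|v 0 i|.
Proof.
have s0 : 0 <= \sum_i `|v 0 i| by apply: sumr_ge0.
rewrite -[leRHS](ger0_norm s0) -sqrtr_sqr ler_wsqrtr // expr2 mulr_suml.
apply: ler_sum => i _; rewrite -real_normK ?num_real // expr2 ler_wpM2l //.
by rewrite (bigD1 i) //= lerDl sumr_ge0.
Qed.

Lemma enormZ a v : enorm (a *: v) = `|a| * enorm v.
Proof.
rewrite /enorm -sqrtr_sqr -sqrtrM ?sqr_ge0 // mulr_sumr.
by congr Num.sqrt; apply: eq_bigr => i _; rewrite mxE exprMn.
Qed.

End EuclideanNorm.

Lemma int_inv_sqr (a b : int) : a * b = 1 -> a * a = 1.
Proof.
move=> /(congr1 absz)/eqP; rewrite abszM muln_eq1 => /andP[/eqP a1 _].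
by have [->|->] : a = 1 \/ a = -1 by lia.
Qed.

Section Covolume.
Variables (m : nat) (Lambda : set 'rV[int]_m).

Lemma lattice_basis_mul k k' (B : 'M[int]_(k, m)) (B' : 'M[int]_(k', m)) :
  lattice_basis Lambda B -> lattice_basis Lambda B' -> exists T, B' = T *m B.
Proof.
move=> [_ _ surjB] [funB' _ _].
have rowB i : exists c : 'rV[int]_k, row i B' = c *m B.
  have : Lambda (row i B') by rewrite rowE; exact: funB'.
  by move=> /surjB[c _ <-]; exists c.
have /choice[c cE] := rowB; exists (\matrix_i c i).
by apply/row_matrixP => i; rewrite row_mul rowK.
Qed.

Lemma lattice_basis_inv k k' (B : 'M[int]_(k, m)) (B' : 'M[int]_(k', m)) T T' :
  lattice_basis Lambda B -> B' = T *m B -> B = T' *m B' -> T' *m T = 1%:M.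
Proof.
move=> [_ injB _] eB' eB.
apply/row_matrixP => i; apply: injB; rewrite ?in_setE //.
by rewrite -!row_mul -mulmxA -eB' -eB mul1mx.
Qed.

(** Two bases differ by mutually inverse integer matrices, so they have equal rank, and the Gram
    determinant changes by the square of a unit of [int]. *)
Lemma lattice_basis_gram k k' (B : 'M[int]_(k, m)) (B' : 'M[int]_(k', m)) :
  lattice_basis Lambda B -> lattice_basis Lambda B' ->
  \det (B' *m B'^T) = \det (B *m B^T).
Proof.
move=> bB bB'.
have [T eB'] := lattice_basis_mul bB bB'; have [T' eB] := lattice_basis_mul bB' bB.
have T'T := lattice_basis_inv bB eB' eB; have TT' := lattice_basis_inv bB' eB eB'.
have ek : k = k' by apply/eqP; rewrite eqn_leq (mulmx1_min T'T) (mulmx1_min TT').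
subst k'; rewrite eB' trmx_mul mulmxA -[T *m B *m B^T]mulmxA !det_mulmx det_tr.
have : \det T' * \det T = 1 by rewrite -det_mulmx T'T det1.
rewrite mulrC => /int_inv_sqr dT.
by rewrite mulrAC dT mul1r.
Qed.

Lemma covolumeE (R : realType) k (B : 'M[int]_(k, m)) : lattice_basis Lambda B ->
  covolume R Lambda = Num.sqrt (\det (B *m B^T))%:~R.
Proof.
move=> bB; apply: xget_unique; first by exists k, B.
by move=> h [k' [B' [bB' ->]]]; rewrite (lattice_basis_gram bB bB').
Qed.

End Covolume.

(** Smith normal form of a single column: the first column of [L] is the primitive vector underlying
    [x], completed to a basis of the integer lattice. *)
Lemma primitive_completion n (x : 'cV[int]_(1 + n)) : x != 0 ->
  exists2 L : 'M[int]_(1 + n), L \in unitmx &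
  exists2 a : int, a != 0 & x = a *: lsubmx L.
Proof.
move=> x0; have [L Lu [S Su [d _ xE]]] := int_Smith_normal_form x.
exists L => //; exists (d`_0 * S 0 0).
  apply: contraNneq x0 => a0; rewrite xE; apply/eqP/colP => i.
  rewrite !mxE big_ord1 !ord1 !mxE (bigD1 0) //= big1 => [|j j0].
    by rewrite !mxE /= mulr1n addr0 -mulrA a0 mulr0.
  by rewrite !mxE; case: eqP => [j00|]; rewrite ?mulr0n ?mulr0 //; case/eqP: j0; apply/val_inj.
apply/colP => i; rewrite [in LHS]xE !mxE big_ord1 !ord1 !mxE (bigD1 0) //= big1 => [|j j0].
  rewrite !mxE /= mulr1n addr0 -mulrA [RHS]mulrC; congr (L i _ * _).
  by apply/val_inj.
by rewrite !mxE; case: eqP => [j00|]; rewrite ?mulr0n ?mulr0 //; case/eqP: j0; apply/val_inj.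
Qed.

Lemma inverse_blocks n (M : 'M[int]_(1 + n)) : M \in unitmx ->
  [/\ usubmx (invmx M) *m lsubmx M = 1%:M, dsubmx (invmx M) *m lsubmx M = 0 &
      dsubmx (invmx M) *m rsubmx M = 1%:M].
Proof.
move=> Mu; pose r0 := usubmx (invmx M); pose B := dsubmx (invmx M).
have MV : block_mx (r0 *m lsubmx M) (r0 *m rsubmx M) (B *m lsubmx M) (B *m rsubmx M)
    = block_mx 1%:M 0 0 1%:M :> 'M[int]_(1 + n).
  by rewrite -mul_col_row vsubmxK hsubmxK mulVmx // scalar_mx_block.
by have [-> _ -> ->] := eq_block_mx MV.
Qed.

Section Heights.
Variables (R : realType) (n : nat).

Lemma intmx_inj m : injective (@intmx R m).
Proof.
by move=> x y /rowP xy; apply/rowP => i; have := xy i; rewrite !mxE => /intr_inj.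
Qed.

Lemma intmxZ m a (x : 'rV[int]_m) : intmx R (a *: x) = a%:~R *: intmx R x.
Proof. by apply/rowP => i; rewrite !mxE rmorphM. Qed.

Lemma enorm_gram (y : 'rV[int]_(1 + n)) :
  Num.sqrt (\det (y *m y^T))%:~R = enorm (intmx R y).
Proof.
rewrite det_mx11 mxE rmorph_sum; congr Num.sqrt.
by apply: eq_bigr => i _; rewrite !mxE rmorphM expr2.
Qed.

Lemma linear_hull_point (q : 'rV[R]_n) :
  linear_hull [set q] = [set v | exists r, v = r *: homog q].
Proof.
apply/seteqP; split=> v /=.
  move=> [k [c [x [xq ->]]]]; exists (\sum_i c i); rewrite scaler_suml.
  by apply: eq_bigr => i _; rewrite xq.
move=> [r ->]; exists 1%N, (fun=> r), (fun=> q); split=> //.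
by rewrite big_ord1.
Qed.

(** The primitive vector [y] generates the lattice: from [y *m r0 = 1] the coefficient of an integer
    point on the line is [z *m r0], an integer. *)
Lemma height_point (p : 'rV[int]_(1 + n)) (q : 'rV[R]_n) : p 0 0 != 0 ->
  intmx R p = (p 0 0)%:~R *: homog q ->
  exists y a, p = a *: y /\ height [set q] = enorm (intmx R y).
Proof.
move=> p0 pq.
have [|L Lu [a a0 pE]] := @primitive_completion n p^T.
  by apply: contra_neq p0 => /(congr1 trmx); rewrite trmxK => ->; rewrite !mxE.
pose y := (lsubmx L)^T; pose r0 := (usubmx (invmx L))^T.
have py : p = a *: y by rewrite -[p]trmxK pE linearZ.
have yr0 : y *m r0 = 1%:M.
  by rewrite -trmx_mul; have [-> _ _] := inverse_blocks Lu; rewrite trmx1.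
exists y, a; split=> //; rewrite -enorm_gram; apply: covolumeE.
have hull z : integer_points (linear_hull [set q]) z <->
    exists r, intmx R z = r *: intmx R y.
  rewrite /integer_points linear_hull_point /=; have p0R : (p 0 0)%:~R != 0 :> R.
    by rewrite intr_eq0.
  have a0R : a%:~R != 0 :> R by rewrite intr_eq0.
  have qy : homog q = ((p 0 0)%:~R^-1 * a%:~R) *: intmx R y.
    by rewrite -scalerA -intmxZ -py pq scalerA mulVf // scale1r.
  split=> -[r zr].
    by exists (r * ((p 0 0)%:~R^-1 * a%:~R)); rewrite -scalerA -qy -zr.
  exists (r * ((p 0 0)%:~R / a%:~R)); rewrite qy scalerA -/(intmx R z) zr.
  by congr (_ *: _); field; rewrite p0R a0R.
split.
- move=> c _ /=; apply/hull; exists (c 0 0)%:~R.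
  by rewrite [c]mx11_scalar mul_scalar_mx intmxZ mxE eqxx mulr1n.
- by move=> c c' _ _ /(congr1 (mulmx^~ r0)); rewrite -!mulmxA yr0 !mulmx1.
- move=> z /hull[r zr]; exists (z *m r0) => //; apply: intmx_inj.
  have -> : intmx R (z *m r0 *m y) = intmx R z *m map_mx intr r0 *m intmx R y.
    by rewrite /intmx !map_mxM.
  rewrite zr -!scalemxAl; congr (_ *: _).
  by rewrite -map_mxM yr0 map_mx1 mul1mx.
Qed.

(** Stack the primitive normal, of squared length [s], on a basis [B] of the lattice orthogonal to
    it, giving [W]. Multiplied by the unimodular [M], [W] becomes triangular with determinant [s],
    while its Gram matrix is block diagonal. Comparing squares gives
    [s * s = s * \det (B *m B^T)]. *)
Lemma height_hyperplane (x : 'cV[int]_(1 + n)) (L : set 'rV[R]_n) : x != 0 ->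
  integer_points (linear_hull L) = [set z | z *m x = 0] ->
  exists f a, x^T = a *: f /\ height L = enorm (intmx R f).
Proof.
move=> x0 hull; have [M Mu [a a0 xE]] := primitive_completion x0.
pose B := dsubmx (invmx M); have [_ Bl Br] := inverse_blocks Mu.
rewrite -/B in Bl Br.
exists (lsubmx M)^T, a; split; first by rewrite xE linearZ.
have bB : lattice_basis (integer_points (linear_hull L)) B.
  rewrite hull; split.
  - by move=> c _ /=; rewrite xE -scalemxAr -mulmxA Bl mulmx0 scaler0.
  - move=> c c' _ _ /(congr1 (mulmx^~ (rsubmx M))).
    by rewrite -!mulmxA Br !mulmx1.
  - move=> z /= zx; exists (z *m rsubmx M) => //=.
    have zl : z *m lsubmx M = 0.
      apply/rowP => i; rewrite ord1 [RHS]mxE; move: zx.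
      rewrite xE -scalemxAr => /rowP/(_ 0); rewrite !mxE => /eqP.
      by rewrite mulf_eq0 (negPf a0) => /eqP.
    rewrite -[RHS](mulmxK Mu) -{2}[M]hsubmxK mul_mx_row zl.
    by rewrite -[invmx M]vsubmxK mul_row_col mul0mx add0r.
rewrite /height (covolumeE R bB) -enorm_gram trmxK; congr (Num.sqrt _%:~R).
set s := RHS.
have sE : (lsubmx M)^T *m lsubmx M = s%:M by rewrite [LHS]mx11_scalar /s det_mx11.
pose W := col_mx (lsubmx M)^T B.
have WM : \det W * \det M = s.
  rewrite -det_mulmx -{1}[M]hsubmxK mul_col_row sE Bl Br.
  by rewrite det_ublock det1 mulr1 det_scalar1.
have WW : \det W * \det W = s * \det (B *m B^T).
  rewrite -{2}det_tr -det_mulmx tr_col_mx mul_col_row trmxK sE Bl.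
  have -> : (lsubmx M)^T *m B^T = 0 by rewrite -trmx_mul Bl trmx0.
  by rewrite det_ublock det_scalar1.
have M2 : \det M * \det M = 1.
  have := mulmxV Mu; move=> /(congr1 determinant); rewrite det_mulmx det1.
  exact: int_inv_sqr.
have s0 : s != 0.
  rewrite -(intr_eq0 R); apply: contra x0 => /eqP s0.
  suff M0 : lsubmx M = 0 by rewrite xE M0 scaler0.
  apply/trmx_inj; rewrite trmx0; apply: intmx_inj; apply/rowP => i; have := coord_le_enorm (intmx R (lsubmx M)^T) i.
  rewrite -enorm_gram trmxK -/s s0 sqrtr0 normr_le0 => /eqP ->.
  by rewrite !mxE.
apply: (mulfI s0); rewrite -WW -{1}WM -WM.
by rewrite mulrACA M2 mulr1.
Qed.

End Heights.

Lemma int_multiple m (p : 'rV[rat]_m) :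
  exists (D : int) (z : 'rV[int]_m), D != 0 /\ map_mx intr z = D%:~R *: p.
Proof.
pose D := \prod_i denq (p 0 i); exists D.
have pD i : exists a : int, D%:~R * p 0 i = a%:~R.
  exists (\prod_(j | j != i) denq (p 0 j) * numq (p 0 i)).
  rewrite /D (bigD1 i) //= mulrC -{1}[p 0 i]divq_num_den !rmorphM /=.
  have : (denq (p 0 i))%:~R != 0 :> rat by rewrite intr_eq0 denq_neq0.
  by move=> ?; field.
have /choice[a aE] := pD; exists (\row_i a i); split.
  by apply/prodf_neq0 => i _; exact: denq_neq0.
by apply/rowP => i; rewrite !mxE aE.
Qed.

(** * Rational points against integer vectors *)

Section Affine.
Variable R : realType.

Lemma homog0 n (q : 'rV[R]_n) : homog q 0 0 = 1.
Proof.
have -> : 0 = lshift n 0 :> 'I_(1 + n) by apply/val_inj.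
by rewrite /homog row_mxEl mxE eqxx.
Qed.

Lemma homogE n (q : 'rV[R]_n) j : homog q 0 (rshift 1 j) = q 0 j.
Proof. by rewrite /homog row_mxEr. Qed.

Lemma homogB_le n (q q' : 'rV[R]_n) i :
  `|homog q 0 i - homog q' 0 i| <= enorm (q - q').
Proof.
have [->|[j ->]] : i = 0 \/ exists j, i = rshift 1 j.
  case: (splitP i) => j ij; last by right; exists j; apply/val_inj.
  by left; apply/val_inj; rewrite /= ij ord1.
  by rewrite !homog0 subrr normr0 enorm_ge0.
by rewrite !homogE (le_trans _ (coord_le_enorm _ j)) // !mxE.
Qed.

Lemma euclid_dist1 n (theta q : 'rV[R]_n) : euclid_dist theta [set q] = enorm (theta - q).
Proof. by rewrite /euclid_dist image_set1 inf1. Qed.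

Lemma rational_affine0 n (L : set 'rV[R]_n) :
  rational_affine 0 L <-> exists p : 'rV[rat]_n, L = [set map_mx ratr p].
Proof.
have pt (p : 'rV[rat]_n) (V : 'M[rat]_(0, n)) :
    [set x | exists t : 'rV[R]_0, x = map_mx ratr p + t *m map_mx ratr V] =
    [set map_mx ratr p].
  apply/seteqP; split=> x /=.
    by move=> [t ->]; rewrite [t]thinmx0 mul0mx addr0.
  by move=> ->; exists 0; rewrite mul0mx addr0.
split=> [[p [V [_ ->]]]|[p ->]]; first by exists p; exact: pt.
exists p, 0; split; last by rewrite pt.
by rewrite /row_free mxrank0.
Qed.

Lemma map_ratr_int m k (z : 'M[int]_(m, k)) :
  map_mx (ratr : rat -> R) (map_mx intr z) = map_mx intr z.
Proof. by apply/matrixP => i j; rewrite !mxE ratr_int. Qed.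

Lemma map_ratr_homog n (p : 'rV[rat]_n) :
  map_mx (ratr : rat -> R) (row_mx 1%:M p) = homog (map_mx ratr p).
Proof. by rewrite map_row_mx map_mx1. Qed.

Lemma point_of_affine n (theta : 'rV[R]_n) L : rational_affine 0 L ->
  point_approx theta (height L) (height L * euclid_dist theta L).
Proof.
move=> /rational_affine0[p ->]; have [D [z [D0 zD]]] := int_multiple (row_mx 1%:M p).
have zR : intmx R z = D%:~R *: homog (map_mx ratr p).
  by rewrite /intmx -map_ratr_int zD map_mxZ /= ratr_int map_ratr_homog.
have z0 : z 0 0 = D.
  by apply: (@intr_inj R); have /rowP/(_ 0) := zR; rewrite [LHS]mxE [X in _ = X -> _]mxE homog0 mulr1.
have [] := @height_point R n z (map_mx ratr p); rewrite ?z0 //.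
move=> y [a [zy ->]]; rewrite euclid_dist1.
have a0 : a != 0 by apply: contra_neq D0 => a0; rewrite -z0 zy a0 scale0r mxE.
have yR : intmx R y = (y 0 0)%:~R *: homog (map_mx ratr p).
  apply: (@scalerI _ _ a%:~R); first by rewrite intr_eq0.
  by rewrite -intmxZ -zy zR -z0 zy mxE rmorphM scalerA.
exists y; split=> [| |i].
- by apply: contra_neq D0 => y0; rewrite -z0 zy mxE y0 mulr0.
- by have := coord_le_enorm (intmx R y) 0; rewrite mxE.
have -> : (y 0 i)%:~R = (y 0 0)%:~R * homog (map_mx ratr p) 0 i :> R.
  by have /rowP/(_ i) := yR; rewrite mxE [RHS]mxE.
rewrite -mulrBr normrM distrC ler_pM // ?homogB_le //.
  by have := coord_le_enorm (intmx R y) 0; rewrite mxE.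
Qed.

Definition theta_size n (theta : 'rV[R]_n) : R := \sum_i `|homog theta 0 i|.

Lemma theta_size_ge0 n (theta : 'rV[R]_n) : 0 <= theta_size theta.
Proof. exact: sumr_ge0. Qed.

Lemma enorm_multiple m (f g : 'rV[int]_m) a : f != 0 -> f = a *: g ->
  enorm (intmx R g) <= enorm (intmx R f).
Proof.
move=> f0 fg; rewrite fg intmxZ enormZ ler_peMl ?enorm_ge0 //.
rewrite -intr_norm -[1]/(1%:~R) ler_int.
have : a != 0 by apply: contra_neq f0 => a0; rewrite fg a0 scale0r.
lia.
Qed.

(** A common factor of [p] only lowers the height. Since [y <= 1 <= |p 0 0|], every coordinate of
    [p] is bounded by a multiple of its denominator. *)
Lemma affine_of_point n (theta : 'rV[R]_n) x y : y <= 1 -> point_approx theta x y ->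
  exists L, [/\ rational_affine 0 L, height L <= (theta_size theta + (1 + n)%:R) * x &
    height L * euclid_dist theta L <=
      (1 + n)%:R * (theta_size theta + (1 + n)%:R) * y].
Proof.
move=> y1 [p [p0 px py]]; set C := theta_size theta + (1 + n)%:R.
have p0R : (p 0 0)%:~R != 0 :> R by rewrite intr_eq0.
have p1 : 1 <= `|(p 0 0)%:~R : R|.
  by rewrite -intr_norm -[1]/(1%:~R) ler_int; lia.
pose q : 'rV[rat]_n := \row_j ((p 0 (rshift 1 j))%:~R / (p 0 0)%:~R).
have pq : intmx R p = (p 0 0)%:~R *: homog (map_mx ratr q).
  apply/rowP => i; rewrite mxE [RHS]mxE.
  case: (splitP i) => j ij.
    have -> : i = 0 by apply/val_inj; rewrite /= ij ord1.
    by rewrite homog0 mulr1.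
  have -> : i = rshift 1 j by apply/val_inj.
  by rewrite homogE !mxE fmorph_div /= !ratr_int mulrC divfK.
have [z [a [pz hz]]] := height_point p0 pq.
have pn0 : p != 0 by apply: contra_neq p0 => ->; rewrite mxE.
have hp : height [set map_mx ratr q] <= C * `|(p 0 0)%:~R|.
  rewrite hz (le_trans (enorm_multiple pn0 pz)) // (le_trans (enorm_le_sum _)) //.
  have -> : C * `|(p 0 0)%:~R| =
      \sum_i (`|homog theta 0 i| * `|(p 0 0)%:~R| + `|(p 0 0)%:~R|).
    by rewrite big_split -mulr_suml sumr_const card_ord -(mulr_natl `|_|) mulrDl.
  apply: ler_sum => i _.
  rewrite mxE -[X in `|X| <= _](subrK ((p 0 0)%:~R * homog theta 0 i)).
  rewrite (le_trans (ler_normD _ _)) // addrC lerD //.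
    by rewrite normrM mulrC.
  by rewrite (le_trans (py i)) // (le_trans y1).
have C0 : 0 <= C by rewrite addr_ge0 ?theta_size_ge0.
exists [set map_mx ratr q]; split.
- by apply/rational_affine0; exists q.
- by rewrite (le_trans hp) // ler_wpM2l.
rewrite euclid_dist1; apply: (@le_trans _ _ (C * (`|(p 0 0)%:~R| * enorm (theta - map_mx ratr q)))).
  by rewrite mulrA ler_wpM2r ?enorm_ge0.
rewrite -enormZ mulrAC mulrC ler_wpM2r //.
rewrite (le_trans (enorm_le_sum _)) //.
apply: (@le_trans _ _ (\sum_(i < n) y)).
  apply: ler_sum => j _; have := py (rshift 1 j); rewrite distrC; apply: le_trans.
  have -> : (p 0 (rshift 1 j))%:~R = (p 0 0)%:~R * (map_mx ratr q) 0 j :> R.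
    by have /rowP/(_ (rshift 1 j)) := pq; rewrite mxE [RHS]mxE homogE.
  by rewrite homogE -mulrBr !mxE.
rewrite sumr_const card_ord -(mulr_natl y) ler_wpM2r ?ler_nat //.
exact: le_trans (normr_ge0 _) (py 0).
Qed.

End Affine.

Lemma row_free_of_rank (K : fieldType) m n r (A : 'M[K]_(m, n)) : \rank A = r ->
  exists V : 'M[K]_(r, n), row_free V /\ (V :=: A)%MS.
Proof. by move=> <-; exists (row_base A); split; [exact: row_base_free|exact: eq_row_base]. Qed.

(** * Rational hyperplanes against integer forms *)

Section Hyperplane.
Variables (R : realType) (n : nat).
Implicit Types (L : set 'rV[R]_n.+1) (x : 'cV[int]_(1 + n.+1)).

Definition hull_mx (K : fieldType) (p : 'rV[K]_n.+1) (V : 'M[K]_(n, n.+1)) :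
  'M[K]_(1 + n, 1 + n.+1) := block_mx 1%:M p 0 V.

Lemma rank_hull_mx (p : 'rV[rat]_n.+1) V : row_free V -> \rank (hull_mx p V) = n.+1.
Proof.
move=> /row_freeP[V' VV']; apply/eqP; apply/row_freeP.
exists (block_mx 1%:M (- (p *m V')) 0 V').
by rewrite mulmx_block !mul1mx !mul0mx !mulmx0 !addr0 !add0r VV' addNr -scalar_mx_block.
Qed.

Lemma rank_annihilator (K : fieldType) m (x : 'cV[K]_m) : x != 0 -> \rank (kermx x) = m.-1.
Proof.
move=> x0; rewrite mxrank_ker; have := rank_leq_col x.
by have := mxrank_eq0 x; rewrite (negPf x0); case: (\rank x) => [//|[|//]]; rewrite subn1.
Qed.

Lemma homog_affine (p : 'rV[R]_n.+1) (V : 'M[R]_(n, n.+1)) t :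
  homog (p + t *m V) = row_mx 1%:M t *m hull_mx p V.
Proof. by rewrite mul_row_block !mul1mx mulmx0 addr0. Qed.

(** A direction is a difference of two homogenized points, so the points [p] and [p + row j V]
    suffice, with [p] absorbing the coefficient [s - \sum_j t 0 j]. *)
Lemma hull_points (p : 'rV[R]_n.+1) (V : 'M[R]_(n, n.+1)) (c : 'rV[R]_(1 + n)) :
  linear_hull [set y | exists t, y = p + t *m V] (c *m hull_mx p V).
Proof.
rewrite -[c]hsubmxK [lsubmx c]mx11_scalar; move: (lsubmx c 0 0) (rsubmx c) => {c}s t.
exists n.+1, (fun i => if unlift ord0 i is Some j then t 0 j else s - \sum_j t 0 j),
  (fun i => if unlift ord0 i is Some j then p + row j V else p); split.
  move=> i; case: (unlift ord0 i) => [j|] /=.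
    by exists (delta_mx 0 j); rewrite rowE.
  by exists 0; rewrite mul0mx addr0.
rewrite big_ord_recl unlift_none /=.
under [X in _ = _ + X]eq_bigr => j _ do rewrite liftK.
have hp : homog p = row_mx 1%:M 0 *m hull_mx p V.
  by rewrite -homog_affine mul0mx addr0.
have hj j : homog (p + row j V) = row_mx 1%:M (delta_mx 0 j) *m hull_mx p V.
  by rewrite -homog_affine rowE.
under [X in _ = _ + X]eq_bigr => j _ do rewrite hj scalemxAl.
rewrite hp scalemxAl -mulmx_suml -mulmxDl; congr (_ *m _).
apply/rowP => i; rewrite [RHS]mxE summxE.
case: (splitP i) => j ij.
  have -> : i = lshift n j by apply/val_inj.
  rewrite row_mxEl ord1 [X in _ = X + _]mxE row_mxEl !mxE eqxx mulr1.
  under [X in _ = _ + X]eq_bigr => k _ do rewrite mxE row_mxEl mxE eqxx mulr1.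
  by rewrite subrK.
have -> : i = rshift 1 j by apply/val_inj.
rewrite row_mxEr [X in _ = X + _]mxE row_mxEr [X in _ = _ * X + _]mxE mulr0 add0r.
rewrite (bigD1 j) //= big1.
  by rewrite mxE row_mxEr mxE !eqxx mulr1 addr0.
by move=> k kj; rewrite mxE row_mxEr mxE eq_sym (negPf kj) andbF mulr0.
Qed.

(** Over the rationals the row space of [hull_mx p V] lies in the annihilator of [x] and has the
    same rank [n.+1], so the two coincide. An integer point orthogonal to [x] is therefore a
    rational combination of the rows. *)
Lemma integer_points_hyperplane L x : x != 0 -> rational_affine n L ->
  (forall P, L P -> homog P *m map_mx intr x = 0) ->
  integer_points (linear_hull L) = [set z | z *m x = 0].
Proof.
move=> x0 [p [V [fV LE]]] Lx.
pose pR := map_mx (ratr : rat -> R) p; pose VR := map_mx (ratr : rat -> R) V.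
have WR : map_mx (ratr : rat -> R) (hull_mx p V) = hull_mx pR VR.
  by rewrite map_block_mx map_mx1 map_mx0.
have {}LE : L = [set y | exists t, y = pR + t *m VR] by [].
apply/seteqP; split=> z /=.
  move=> [k [c [y [Ly zE]]]]; apply/trmx_inj; apply: (@intmx_inj R).
  rewrite trmx0 /intmx -map_trmx map_mxM zE mulmx_suml big1 ?trmx0 ?map_mx0 // => i _.
  by rewrite -scalemxAl Lx ?scaler0.
move=> zx; rewrite /integer_points /= LE.
have W0 : hull_mx p V *m map_mx intr x = 0.
  apply: (map_mx_inj (f := ratr : {rmorphism rat -> R})).
  rewrite map_mxM map_mx0 map_ratr_int /= WR; apply/row_matrixP => i.
  rewrite row_mul row0; case: (splitP i) => j ij.
    have -> : row i (hull_mx pR VR) = homog pR.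
      have -> : i = lshift n j by apply/val_inj.
      by rewrite /hull_mx block_mxEv rowKu row_id.
    by rewrite Lx // LE; exists 0; rewrite mul0mx addr0.
  have -> : row i (hull_mx pR VR) =
      homog (pR + row j VR) - homog pR.
    have -> : i = rshift 1 j by apply/val_inj.
    rewrite /hull_mx block_mxEv rowKd row_row_mx row0 /homog.
    by rewrite opp_row_mx add_row_mx subrr addrAC subrr add0r.
  rewrite mulmxBl !Lx ?subrr // LE; first by exists 0; rewrite mul0mx addr0.
  by exists (delta_mx 0 j); rewrite rowE.
have xQ0 : map_mx intr x != 0 :> 'cV[rat]_(1 + n.+1).
  apply: contra_neq x0 => x0; apply/matrixP => i j.
  by have /matrixP/(_ i j) := x0; rewrite !mxE => /eqP; rewrite intr_eq0 => /eqP.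
have : (map_mx (intr : int -> rat) z <= hull_mx p V)%MS.
  have sub : (hull_mx p V <= kermx (map_mx intr x))%MS by apply/sub_kermxP.
  have := mxrank_leqif_sup sub; rewrite rank_annihilator // rank_hull_mx // => -[_].
  rewrite eqxx => /esym sup; apply: submx_trans sup.
  by apply/sub_kermxP; rewrite -map_mxM zx map_mx0.
move=> /submxP[c zc]; rewrite -map_ratr_int zc map_mxM WR.
exact: hull_points.
Qed.

End Hyperplane.

Section Forms.
Variables (R : realType) (n : nat).
Implicit Types (L : set 'rV[R]_n.+1) (theta : 'rV[R]_n.+1) (f : 'rV[int]_(1 + n.+1)).

Lemma dot_mulmx m (x y : 'rV[R]_m) : y *m x^T = (dot x y)%:M.
Proof.
rewrite [LHS]mx11_scalar mxE; congr _%:M.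
by apply: eq_bigr => i _; rewrite mxE mulrC.
Qed.

Lemma dot_mulmx_eq0 (a : int) f (x : 'cV[int]_(1 + n.+1)) (v : 'rV[R]_(1 + n.+1)) :
  a != 0 -> x^T = a *: f -> v *m map_mx intr x = 0 <-> dot (intmx R f) v = 0.
Proof.
move=> a0 xf; have -> : map_mx intr x = a%:~R *: (intmx R f)^T.
  by apply/trmx_inj; rewrite map_trmx xf linearZ /= trmxK -intmxZ.
rewrite -scalemxAr dot_mulmx; split=> [/rowP/(_ 0)|->].
  by rewrite !mxE eqxx mulr1n => /eqP; rewrite mulf_eq0 intr_eq0 (negPf a0) => /eqP.
by rewrite scale_scalar_mx mulr0 raddf0.
Qed.

Lemma enorm_int_ge1 m (v : 'rV[int]_m) : v != 0 -> 1 <= enorm (intmx R v).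
Proof.
move=> /matrix0Pn[j [i]]; rewrite ord1 => vi.
apply: le_trans (coord_le_enorm _ i); rewrite mxE -intr_norm -[1]/(1%:~R) ler_int.
by rewrite -gtz0_ge1 normr_gt0.
Qed.

Lemma euclid_dist_le m (t P : 'rV[R]_m) (L : set 'rV[R]_m) :
  L P -> euclid_dist t L <= enorm (t - P).
Proof.
move=> LP; apply: ge_inf; last by exists P.
by exists 0 => _ [Q _ <-]; exact: enorm_ge0.
Qed.

(** An integer normal comes from the cokernel of [hull_mx], cleared of denominators; its primitive
    part [f] has norm [height L]. As [f] vanishes on [L], its value at [theta] is its value on the
    difference with any point of [L]. *)
Lemma form_of_affine theta L : rational_affine n L ->
  form_approx theta (height L) ((1 + n.+1)%:R * (height L * euclid_dist theta L)).
Proof.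
move=> rL; have [p [V [fV LE]]] := rL.
have : cokermx (hull_mx p V) != 0.
  by rewrite -mxrank_eq0 mxrank_coker rank_hull_mx // add1n subSnn.
move=> /matrix0Pn[i [j Kij]].
have xj : col j (cokermx (hull_mx p V)) != 0 by apply/matrix0Pn; exists i, 0; rewrite mxE.
have [D [z [D0 zD]]] := int_multiple (col j (cokermx (hull_mx p V)))^T.
pose x := z^T; have xE : map_mx intr x = D%:~R *: col j (cokermx (hull_mx p V)).
  by rewrite /x -map_trmx zD linearZ /= trmxK.
have x0 : x != 0.
  apply: contra_neq xj => x0; apply: (@scalerI _ _ D%:~R); first by rewrite intr_eq0.
  by rewrite -xE x0 map_mx0 scaler0.
pose pR := map_mx (ratr : rat -> R) p; pose VR := map_mx (ratr : rat -> R) V.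
have WR : map_mx (ratr : rat -> R) (hull_mx p V) = hull_mx pR VR.
  by rewrite map_block_mx map_mx1 map_mx0.
have Lx P : L P -> homog P *m map_mx intr x = 0.
  rewrite LE => -[t ->]; rewrite homog_affine -mulmxA -WR -(map_ratr_int R x).
  rewrite -map_mxM xE -scalemxAr colE mulmxA mulmx_coker mul0mx scaler0.
  by rewrite map_mx0 mulmx0.
have [f [a [xf hL]]] := height_hyperplane x0 (integer_points_hyperplane x0 rL Lx).
have a0 : a != 0.
  apply: contra_neq x0 => a0; apply/trmx_inj.
  by rewrite xf a0 scale0r trmx0.
have f0 : f != 0.
  by apply: contra_neq x0 => f0; apply/trmx_inj; rewrite xf f0 scaler0 trmx0.
have ef := enorm_int_ge1 f0.
exists f; split=> // [l|]; first by rewrite hL; have := coord_le_enorm (intmx R f) l; rewrite mxE.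
have M0 : 0 < (1 + n.+1)%:R * enorm (intmx R f).
  by rewrite mulr_gt0 ?ltr0n // (lt_le_trans ltr01).
rewrite hL mulrA mulrC -ler_pdivrMr //; apply: lb_le_inf.
  by rewrite LE; exists (enorm (theta - pR)), pR => //; exists 0; rewrite mul0mx addr0.
move=> _ [P LP <-]; rewrite ler_pdivrMr // mulrC -mulrA.
have P0 : dot (intmx R f) (homog P) = 0 by apply/(dot_mulmx_eq0 _ a0 xf); exact: Lx.
have -> : dot (intmx R f) (homog theta) = dot (intmx R f) (homog theta - homog P).
  by rewrite dotDr dotNr P0 subr0.
apply: dot_norm_le => l; first exact: coord_le_enorm.
by rewrite -[homog P]scale1r row_subZE mul1r homogB_le.
Qed.

Lemma rational_hyperplane f : rsubmx f != 0 ->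
  rational_affine n [set P : 'rV[R]_n.+1 | dot (intmx R f) (homog P) = 0].
Proof.
move=> /matrix0Pn[i0 [j]]; rewrite ord1 mxE => fj.
pose aQ : 'cV[rat]_n.+1 := map_mx intr (rsubmx f)^T.
pose aR : 'cV[R]_n.+1 := map_mx intr (rsubmx f)^T.
have aR_Q : map_mx (ratr : rat -> R) aQ = aR by rewrite map_ratr_int.
have aQ0 : aQ != 0.
  apply: contra_neq fj => aQ0; have /colP/(_ j) := aQ0; rewrite !mxE => /eqP.
  by rewrite intr_eq0 => /eqP.
have rK := rank_annihilator aQ0.
have [V [fV VK]] := row_free_of_rank rK.
pose p : 'rV[rat]_n.+1 := (- (f 0 0)%:~R / (f 0 (rshift 1 j))%:~R) *: delta_mx 0 j.
exists p, V; split=> //.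
have dotE (P : 'rV[R]_n.+1) : dot (intmx R f) (homog P) = (f 0 0)%:~R + (P *m aR) 0 0.
  rewrite /dot big_split_ord /= big_ord1 mxE [X in _ = _ + X]mxE.
  have -> : lshift n.+1 0 = 0 :> 'I_(1 + n.+1) by apply/val_inj.
  rewrite homog0 mulr1; congr (_ + _); apply: eq_bigr => i _.
  by rewrite homogE !mxE mulrC.
have pa : (map_mx (ratr : rat -> R) p *m aR) 0 0 = - (f 0 0)%:~R.
  rewrite map_mxZ -scalemxAl map_delta_mx -rowE mxE !mxE.
  rewrite fmorph_div rmorphN /= !ratr_int divfK // intr_eq0 //.
have kerR (v : 'rV[R]_n.+1) : (v *m aR = 0) <-> exists t, v = t *m map_mx ratr V.
  split=> [/sub_kermxP|[t ->]].
    rewrite -aR_Q -map_kermx => h; apply/submxP; apply: submx_trans h _.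
    by rewrite map_submx VK.
  rewrite -mulmxA -aR_Q -map_mxM; have : (V <= kermx aQ)%MS by rewrite VK.
  by move=> /sub_kermxP ->; rewrite map_mx0 mulmx0.
apply/seteqP; split=> P /=.
  rewrite dotE => Pa; have [|t tE] := (kerR (P - map_mx ratr p)).1.
    apply/rowP => i; rewrite ord1 mulmxBl [RHS]mxE mxE [X in _ + X]mxE pa opprK addrC.
    by rewrite Pa.
  by exists t; rewrite -tE addrC subrK.
move=> [t ->]; rewrite dotE mulmxDl mxE pa.
by rewrite (kerR _).2 ?mxE ?addr0 ?subrr //; exists t.
Qed.

(** The bound [y < 1] rules out a form without linear part, whose value would be a nonzero integer.
    It also controls the constant coefficient, so [f] and its linear part [fa] have comparable norms
    and height times distance is about the value of the form. *)
Lemma affine_of_form theta x y : y < 1 -> form_approx theta x y ->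
  exists L, [/\ rational_affine n L, height L <= (1 + n.+1)%:R * x &
    height L * euclid_dist theta L <= (theta_size theta + (1 + n.+1)%:R) * y].
Proof.
move=> y1 [f [f0 fx fy]]; pose fa := rsubmx f.
have split_dot (P : 'rV[R]_n.+1) : dot (intmx R f) (homog P) =
    (f 0 0)%:~R + dot (intmx R fa) P.
  rewrite /dot big_split_ord /= big_ord1 mxE.
  have -> : lshift n.+1 0 = 0 :> 'I_(1 + n.+1) by apply/val_inj.
  rewrite homog0 mulr1; congr (_ + _); apply: eq_bigr => i _.
  by rewrite homogE !mxE.
have s1 : `|dot (intmx R f) (homog theta)| < 1 by apply: le_lt_trans fy y1.
have fa0 : fa != 0.
  apply/eqP => fa0; move: s1; rewrite split_dot fa0 /dot big1 => [|i _]; last first.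
    by rewrite !mxE mul0r.
  rewrite addr0 -intr_norm -[1]/(1%:~R) ltr_int => f00.
  move/eqP: f0; apply; rewrite -[f]hsubmxK -/fa fa0 -[RHS](row_mx0); congr row_mx.
  apply/rowP => i; rewrite ord1 !mxE.
  have -> : lshift n.+1 0 = 0 :> 'I_(1 + n.+1) by apply/val_inj.
  lia.
pose L := [set P : 'rV[R]_n.+1 | dot (intmx R f) (homog P) = 0].
have rL : rational_affine n L by exact: rational_hyperplane.
have fT0 : f^T != 0 by apply: contra_neq f0 => h; apply/trmx_inj; rewrite h trmx0.
have [|g [a [fg hL]]] := @height_hyperplane R _ _ L fT0.
  apply: integer_points_hyperplane => // P LP.
  by apply/(@dot_mulmx_eq0 1 f); rewrite ?trmxK ?scale1r.
rewrite trmxK in fg.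
have hf : height L <= enorm (intmx R f) by rewrite hL; exact: enorm_multiple fg.
exists L; split=> //.
  rewrite (le_trans hf) // (le_trans (enorm_le_sum _)) //.
  apply: (@le_trans _ _ (\sum_(i < 1 + n.+1) x)).
    by apply: ler_sum => i _; rewrite mxE.
  by rewrite sumr_const card_ord -(mulr_natl x).
set g' := enorm (intmx R fa); have g1 : 1 <= g' by exact: enorm_int_ge1.
have g0 : 0 < g' by rewrite (lt_le_trans ltr01).
set s := dot (intmx R f) (homog theta) in fy s1.
(* The orthogonal projection of [theta] onto [L]. *)
pose P := theta - (s / g' ^+ 2) *: intmx R fa.
have gg : dot (intmx R fa) (intmx R fa) = g' ^+ 2.
  by rewrite /dot /g' /enorm sqr_sqrtr ?sumsq_ge0 //.
have LP : L P.
  rewrite /L /= split_dot /P dotDr dotNr dotZr gg addrA -split_dot -/s.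
  by rewrite divfK ?subrr // expf_neq0 // gt_eqF.
have dP : euclid_dist theta L <= `|s| / g'.
  apply: le_trans (euclid_dist_le _ LP) _.
  rewrite /P subKr enormZ -/g' normrM normfV (ger0_norm (exprn_ge0 2 (ltW g0))).
  by rewrite expr2 invfM -!mulrA mulVf ?mulr1 // gt_eqF.
have fb : enorm (intmx R f) <= (theta_size theta + (1 + n.+1)%:R) * g'.
  rewrite (le_trans (enorm_le_sum _)) // big_split_ord /= big_ord1 mxE.
  have -> : lshift n.+1 0 = 0 :> 'I_(1 + n.+1) by apply/val_inj.
  have fag i : `|(f 0 (rshift 1 i))%:~R| <= g'.
    by have := coord_le_enorm (intmx R fa) i; rewrite !mxE.
  have h1 : \sum_i `|intmx R f 0 (rshift 1 i)| <= n.+1%:R * g'.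
    apply: (@le_trans _ _ (\sum_(i < n.+1) g')).
      by apply: ler_sum => i _; rewrite mxE.
    by rewrite sumr_const card_ord -(mulr_natl g').
  have h2 : `|dot (intmx R fa) theta| <= (theta_size theta - 1) * g'.
    rewrite /theta_size big_split_ord /= big_ord1.
    have -> : lshift n.+1 0 = 0 :> 'I_(1 + n.+1) by apply/val_inj.
    rewrite homog0 normr1 addrAC subrr add0r mulr_suml (le_trans (ler_norm_sum _ _ _)) //.
    by apply: ler_sum => i _; rewrite homogE normrM mulrC ler_wpM2l // !mxE.
  have h3 : `|(f 0 0)%:~R| <= 1 + (theta_size theta - 1) * g'.
    have -> : (f 0 0)%:~R = s - dot (intmx R fa) theta by rewrite /s split_dot addrK.
    by rewrite (le_trans (ler_normB _ _)) // lerD // ltW.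
  rewrite natrD; lra.
have e0 : 0 <= euclid_dist theta L.
  by apply: lb_le_inf; [exists (enorm (theta - P)), P|move=> _ [Q _ <-]; exact: enorm_ge0].
apply: (@le_trans _ _ (enorm (intmx R f) * (`|s| / g'))).
  by rewrite ler_pM // hL enorm_ge0.
rewrite mulrA ler_pdivrMr // mulrAC ler_pM ?enorm_ge0 //.
Qed.

End Forms.

(** * The two uniform exponents *)

Section Exponents.
Variables (R : realType) (n d : nat) (theta : 'rV[R]_n).

(** Logarithmic scale: [h] is the logarithm of the height bound [H]. *)
Definition attains (w h : R) : Prop := exists L : set 'rV[R]_n,
  [/\ rational_affine d L, height L <= expR h &
      height L * euclid_dist theta L <= expR (- (w * h))].

Lemma attainsE (w : R) :
  (\forall H \near +oo, exists L : set 'rV[R]_n,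
     [/\ rational_affine d L, height L <= H &
         height L * euclid_dist theta L <= H `^ (- w)]) <->
  exists h0, forall h, h0 < h -> attains w h.
Proof.
have pw h : expR h `^ (- w) = expR (- (w * h)).
  by rewrite /powR gt_eqF ?expR_gt0 // expRK mulNr.
split=> [[M [_ HM]]|[h0 Hh]].
  exists `|M| => h lt_h.
  have [|L [L1 L2 L3]] := HM (expR h).
    apply: le_lt_trans (ler_norm M) _; apply: lt_le_trans lt_h _.
    by apply: le_trans (expR_ge1Dx h); rewrite lerDr.
  by exists L; rewrite -pw.
exists (expR h0); split; first exact: num_real.
move=> H lt_H; have H0 : 0 < H by apply: le_lt_trans lt_H; exact: expR_ge0.
have [|L [L1 L2 L3]] := Hh (ln H).
  by rewrite -[h0]expRK ltr_ln ?posrE ?expR_gt0.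
by exists L; split=> //; rewrite -[H]lnK ?posrE // pw.
Qed.

Lemma exponent_ge (v : \bar R) : (0%:E < v)%E ->
  (forall w, 0 < w -> (w%:E < v)%E -> exists h0, forall h, h0 < h -> attains w h) ->
  (v <= uniform_exponent d theta)%E.
Proof.
move=> v0 Hw.
have sup_ge w : 0 < w -> (w%:E < v)%E -> (w%:E <= uniform_exponent d theta)%E.
  move=> w0 wv; apply: ereal_sup_ubound; exists w => //=.
  by apply/attainsE; exact: Hw.
case: v v0 {Hw} sup_ge => [r r0 sup_ge|_ sup_ge|//].
  rewrite lte_fin in r0; apply/lee_subgt0Pr => e e0.
  (* The hypothesis covers positive exponents only; [r / 2] keeps [w] positive when [e] is large. *)
  pose w := Num.max (r - e) (r / 2).
  have w0 : 0 < w by rewrite lt_max [X in _ || X]divr_gt0 ?orbT.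
  apply: le_trans (sup_ge w w0 _); first by rewrite lee_fin le_max lexx.
  by rewrite lte_fin gt_max; apply/andP; split; lra.
have /eqyP -> // : forall w, 0 < w -> (w%:E <= uniform_exponent d theta)%E.
by move=> w w0; apply: sup_ge => //; rewrite ltry.
Qed.

Lemma exponent_le (v : R) :
  (forall w h0, v < w -> (forall h, h0 < h -> attains w h) -> False) ->
  (uniform_exponent d theta <= v%:E)%E.
Proof.
move=> Hw; apply: ge_ereal_sup => _ [w /= /attainsE[h0 Hh] <-].
by rewrite lee_fin leNgt; apply/negP => vw; exact: Hw vw Hh.
Qed.

End Exponents.

Section Stages.
Variable R : realType.

Lemma unbounded_stage (g : nat -> R) (k0 : nat) (h : R) :
  (forall M, exists k, M < g k) -> (forall k, g k <= g k.+1) -> g k0 <= h ->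
  exists k, (k0 <= k)%N /\ g k <= h < g k.+1.
Proof.
move=> unb mono le_h.
have ex : exists k, h < g k := unb h.
case: (ex_minnP ex) => m hm min_m.
have lt_k0 : (k0 < m)%N.
  rewrite ltnNge; apply/negP => le_m; have := lt_le_trans hm _.
  suff H : g m <= g k0 by move=> /(_ _ H); rewrite ltNge le_h.
  move/subnK: le_m => <-; elim: (k0 - m)%N => // j IH.
  by rewrite addSn (le_trans IH).
case: m hm min_m lt_k0 => // m hm min_m lt_k0; exists m; split=> //.
rewrite hm andbT leNgt; apply/negP => h'.
by have := min_m m h'; rewrite ltnn.
Qed.

Lemma natr_le_low k : k%:R <= low R k.
Proof.
rewrite /low ler_nat (leq_trans _ (fact_geq _)) // -addnn leq_addr //.
Qed.

Lemma low_unbounded (a M : R) : 0 < a -> exists k0, forall k, (k0 <= k)%N ->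
  M < a * low R k /\ M < a * high R k.
Proof.
move=> a0; exists (Num.bound `|M / a|) => k le_k.
suff H : M < a * low R k.
  by split=> //; apply: lt_le_trans H _; rewrite ler_pM2l // low_le_high.
rewrite mulrC -ltr_pdivrMr //; apply: le_lt_trans (ler_norm _) _.
apply: lt_le_trans (archi_boundP (normr_ge0 _)) _.
by apply: le_trans (natr_le_low k); rewrite ler_nat.
Qed.

Lemma form_approx_mono n (theta : 'rV[R]_n) x y x' y' : x <= x' -> y <= y' ->
  form_approx theta x y -> form_approx theta x' y'.
Proof.
move=> xx yy [f [f0 fx fy]]; exists f; split=> // [i|]; first exact: le_trans (fx i) xx.
exact: le_trans yy.
Qed.

Lemma point_approx_mono n (theta : 'rV[R]_n) x y x' y' : x <= x' -> y <= y' ->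
  point_approx theta x y -> point_approx theta x' y'.
Proof.
move=> xx yy [p [p0 px py]]; exists p; split=> // [|i]; first exact: le_trans xx.
exact: le_trans (py i) yy.
Qed.

Lemma const_le_expR (C e S : R) : ln C <= e * S -> 0 < C -> C <= expR (e * S).
Proof. by move=> h C0; rewrite -[leLHS]lnK ?posrE // ler_expR. Qed.

End Stages.

(** * Lower and upper bounds for both exponents *)

Section Main.
Variables (R : realType) (n : nat) (lam vp : R).
Hypothesis n_gt1 : (1 < n.+1)%N.
Hypothesis vp_ge0 : 0 <= vp.
Hypothesis vp_le : vp * n.+1%:R <= 1.
Hypothesis lam_ge : 1 <= vp + (n.+1%:R - 1) * lam.
Hypothesis lam_le : (n.+1%:R - 1) * vp + lam <= 1.
Variables (b : nat -> bool) (theta : 'rV[R]_n.+1).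
Variables (A : nat -> nat) (Y F : nat -> 'rV[int]_(1 + n.+1)).
Hypothesis X : expansion (tau n.+1 lam vp) b theta A Y F.

Let stage e (e0 : 0 < e) := stage_bounds n_gt1 vp_ge0 vp_le lam_ge lam_le X e0.
Let lam0 : 0 < lam := lam_gt0 n_gt1 vp_ge0 vp_le lam_ge.
Let lam1 : lam <= 1 := lam_le1 n_gt1 vp_ge0 lam_le.
Let C : R := (1 + n.+1)%:R * (theta_size theta + (1 + n.+1)%:R).

Let C0 : 0 < C.
Proof. by rewrite mulr_gt0 // ltr_wpDl ?theta_size_ge0. Qed.

Lemma form_exponent_ge w : 0 < w -> w * vp < 1 ->
  exists h0, forall h, h0 < h -> attains n theta w h.
Proof.
(* Small enough for [w * (vp + 2 * e) + 2 * e <= 1] and [w * (2 * e) + 2 * e <= lam], one condition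
   for each of the two forms of a stage. *)
move=> w0 wvp; pose e := Num.min ((1 - w * vp) / (2 * w + 2)) (lam / (2 * w + 2)).
have w2 : 0 < 2 * w + 2 by lra.
have e0 : 0 < e by rewrite lt_min !divr_gt0 //; lra.
have e1 : e * (2 * w + 2) <= 1 - w * vp by rewrite -ler_pdivlMr // ge_min lexx.
have e2 : e * (2 * w + 2) <= lam by rewrite -ler_pdivlMr // ge_min lexx orbT.
have [k1 Hk1] := stage e0; have [k2 Hk2] := low_unbounded (ln C) e0.
pose g k := 2 * e * high R k; pose k0 := maxn k1 k2.
have g_unb M : exists k, M < g k.
  have [k3 /(_ k3 (leqnn _)) [_ H]] := low_unbounded M (mulr_gt0 (ltr0Sn R 1) e0).
  by exists k3.
have g_mono k : g k <= g k.+1.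
  by rewrite ler_pM2l ?mulr_gt0 // high_mono.
exists (g k0) => h /ltW /(unbounded_stage g_unb g_mono)[k [le_k /andP[h1 h2]]].
have le_k1 : (k1 <= k)%N by apply: leq_trans le_k; exact: leq_maxl.
have [_ Ck] := Hk2 k (leq_trans (leq_maxr _ _) le_k).
have [[f1 f2] _ _ _] := Hk1 k le_k1.
have S0 := high_gt0 R k; have S1 := high_gt0 R k.+1.
have SS : high R k <= high R k.+1 by exact: high_mono.
have CS : C <= expR (e * high R k) by apply: const_le_expR => //; exact: ltW.
have eS : e * high R k <= e * high R k.+1 by rewrite ler_pM2l.
have CS1 : C <= expR (e * high R k.+1) by apply: le_trans CS _; rewrite ler_expR.
have n1 : 1 <= (1 + n.+1)%:R :> R by rewrite ler1n.
have C1 : (1 + n.+1)%:R <= C.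
  by rewrite /C ler_peMr // (le_trans n1) // lerDr theta_size_ge0.
have C2 : theta_size theta + (1 + n.+1)%:R <= C.
  by rewrite /C ler_peMl // addr_ge0 // theta_size_ge0.
have lam_e : 0 < lam - e by nra.
have one_e : 0 < 1 - e by have := lam1; lra.
have fin x y : y < 0 -> form_approx theta (expR x) (expR y) ->
    x + e * high R k <= h -> y + e * high R k.+1 <= - (w * h) \/ y + e * high R k <= - (w * h) ->
    attains n theta w h.
  move=> y0 fxy xh yh.
  have [|L [L1 L2 L3]] := affine_of_form _ fxy; first by rewrite -expR0 ltr_expR.
  exists L; split=> //.
    apply: le_trans L2 _; rewrite -ler_expR expRD in xh; apply: le_trans xh.
    by rewrite mulrC ler_pM2l ?expR_gt0 // (le_trans C1).
  apply: le_trans L3 _; case: yh => yh; rewrite -ler_expR expRD in yh.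
    by apply: le_trans yh; rewrite mulrC ler_pM2l ?expR_gt0 // (le_trans C2).
  by apply: le_trans yh; rewrite mulrC ler_pM2l ?expR_gt0 // (le_trans C2).
rewrite /g in h1 h2.
(* Up to this height the cheap form suffices; above it the second form is affordable, and it lasts
   until the cheap form of the next stage. *)
have [le_h|/ltW lt_h] := lerP h ((vp + 2 * e) * high R k).
  have hw : w * h <= w * ((vp + 2 * e) * high R k) by rewrite ler_pM2l.
  have eq1 : (w * (vp + 2 * e) + 2 * e) * high R k <= 1 * high R k.
    by rewrite ler_pM2r //; lra.
  apply: fin f1 _ _; [|lra|right; lra].
  by rewrite oppr_lt0 mulr_gt0.
have hw : w * h <= w * (2 * e * high R k.+1) by rewrite ler_pM2l // ltW.
have eq1 : (w * (2 * e) + 2 * e) * high R k.+1 <= lam * high R k.+1.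
  by rewrite ler_pM2r //; lra.
apply: fin f2 _ _; [|lra|left; lra].
by rewrite oppr_lt0 mulr_gt0.
Qed.

Lemma point_exponent_ge w : 0 < w -> w < lam ->
  exists h0, forall h, h0 < h -> attains 0 theta w h.
Proof.
(* This choice gives [w * (1 + 2 * e) + 2 * e = lam]. *)
move=> w0 wlam; pose e := (lam - w) / (2 * w + 2).
have w2 : 0 < 2 * w + 2 by lra.
have e0 : 0 < e by rewrite divr_gt0 //; lra.
have e1 : e * (2 * w + 2) = lam - w by rewrite divfK // gt_eqF.
have [k1 Hk1] := stage e0; have [k2 Hk2] := low_unbounded (ln C) e0.
pose g k := (1 + 2 * e) * low R k.+1; pose k0 := maxn k1 k2.
have g0 : 0 < 1 + 2 * e by lra.
have g_unb M : exists k, M < g k.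
  have [k3 H] := low_unbounded M g0.
  by exists k3; have [] := H k3.+1 (leqnSn _).
have g_mono k : g k <= g k.+1 by rewrite ler_pM2l // low_mono.
exists (g k0) => h /ltW /(unbounded_stage g_unb g_mono)[k [le_k /andP[h1 h2]]].
have le_k1 : (k1 <= k)%N by apply: leq_trans le_k; exact: leq_maxl.
have le_k2 : (k2 <= k.+1)%N by rewrite leqW // (leq_trans _ le_k) // leq_maxr.
have [Cl Ch] := Hk2 k.+1 le_k2; have [Cl2 _] := Hk2 k.+2 (leqW le_k2).
have [_ [p1 _] _ _] := Hk1 k le_k1; have [_ [_ p2] _ _] := Hk1 k.+1 (leqW le_k1).
have l1 := low_ge1 R k.+1; have l2 := low_ge1 R k.+2; have S1 := high_gt0 R k.+1.
have n1 : 1 <= (1 + n.+1)%:R :> R by rewrite ler1n.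
have C2 : theta_size theta + (1 + n.+1)%:R <= C.
  by rewrite /C ler_peMl // addr_ge0 // theta_size_ge0.
have lam_e : 0 < lam - e by nra.
have one_e : 0 < 1 - e by have := lam1; lra.
have fin x y z : y < 0 -> point_approx theta (expR x) (expR y) ->
    C <= expR z -> forall z', C <= expR z' ->
    x + z <= h -> y + z' <= - (w * h) -> attains 0 theta w h.
  move=> y0 pxy Cz z' Cz' xh yh.
  have [|L [L1 L2 L3]] := affine_of_point _ pxy; first by rewrite -expR0 ler_expR ltW.
  exists L; split=> //.
    apply: le_trans L2 _; rewrite -ler_expR expRD in xh; apply: le_trans xh.
    by rewrite mulrC ler_pM2l ?expR_gt0 // (le_trans C2).
  apply: le_trans L3 _; rewrite -ler_expR expRD in yh; apply: le_trans yh.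
  by rewrite mulrC ler_pM2l ?expR_gt0.
have Cle z : ln C < z -> C <= expR z.
  by move=> /ltW Cz; rewrite -[leLHS]lnK ?posrE // ler_expR.
rewrite /g in h1 h2.
(* The point at the low index serves until the last point of the same period, of denominator about
   [expR (high R k.+1)], becomes affordable. *)
have [le_h|/ltW lt_h] := lerP h ((1 + 2 * e) * high R k.+1).
  have hw : w * h <= w * ((1 + 2 * e) * high R k.+1) by rewrite ler_pM2l.
  have eq1 : (w * (1 + 2 * e) + 2 * e) * high R k.+1 <= lam * high R k.+1.
    by rewrite ler_pM2r //; lra.
  apply: fin p1 (Cle _ Cl) _ (Cle _ Ch) _ _; [|lra|lra].
  by rewrite oppr_lt0 mulr_gt0.
have hw : w * h <= w * ((1 + 2 * e) * low R k.+2) by rewrite ler_pM2l // ltW.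
have l20 : 0 < low R k.+2 by apply: lt_le_trans l2.
have eq1 : (w * (1 + 2 * e) + 2 * e) * low R k.+2 <= 1 * low R k.+2.
  by rewrite ler_pM2r //; have := lam1; lra.
apply: fin p2 (Cle _ Ch) _ (Cle _ Cl2) _ _; [|lra|lra].
by rewrite oppr_lt0 mulr_gt0.
Qed.

(** The test height is [h = (vp - 2 * e) * high R k]. As [w * (vp - 2 * e) = 1 + 2 * e], both terms
    of the obstruction in [stage_bounds] fall below 1/2. *)
Lemma form_exponent_le w h0 : 1 < w * vp -> 0 < w ->
  (forall h, h0 < h -> attains n theta w h) -> False.
Proof.
move=> wvp w0 att; pose e := (w * vp - 1) / (2 * w + 2).
have w2 : 0 < 2 * w + 2 by lra.
have e0 : 0 < e by rewrite divr_gt0 //; lra.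
have e1 : e * (2 * w + 2) = w * vp - 1 by rewrite divfK // gt_eqF.
have d0 : 0 < vp - 2 * e by rewrite -(pmulr_rgt0 _ w0); lra.
have [k1 Hk1] := stage e0; have [k2 Hk2] := low_unbounded h0 d0.
pose D : R := (1 + n.+1)%:R; have D0 : 0 < D by rewrite ltr0n.
have [k3 Hk3] := low_unbounded (ln (2 * D)) e0.
pose k := (k1 + k2 + k3)%N.
have [_ _ H _] := Hk1 k (leq_trans (leq_addr _ _) (leq_addr _ _)).
have [_ lt_h] := Hk2 k (leq_trans (leq_addl _ _) (leq_addr _ _)).
have [_ lt_D] := Hk3 k (leq_addl _ _).
have [L [L1 L2 L3]] := att _ lt_h.
have := H _ _ (form_approx_mono L2 (lexx _) (form_of_affine theta L1)).
apply/negP; rewrite -ltNge.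
have S0 := high_gt0 R k.
have DD : D * expR (- (e * high R k)) < 1 / 2.
  rewrite expRN ltr_pdivrMr ?expR_gt0 // mul1r ltr_pdivlMl //.
  by rewrite -[ltLHS]lnK ?posrE ?mulr_gt0 // ltr_expR.
have eq1 : (1 + 2 * e) * high R k <= (w * (vp - 2 * e)) * high R k.
  by rewrite ler_pM2r //; lra.
have t1 : D * (expR ((vp - 2 * e) * high R k) * expR (- ((vp - e) * high R k))) < 1 / 2.
  rewrite -expRD (_ : _ + _ = - (e * high R k)) //; ring.
have t2 : expR ((1 + e) * high R k) * (D * (height L * euclid_dist theta L)) < 1 / 2.
  rewrite mulrCA; apply: le_lt_trans DD; rewrite ler_pM2l //.
  apply: le_trans (ler_wpM2l (expR_ge0 _) L3) _.
  by rewrite -expRD ler_expR; lra.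
rewrite -/D; lra.
Qed.

(** Same scheme with [h = (1 - 2 * e) * high R k], where [w * (1 - 2 * e) = lam + 2 * e]. *)
Lemma point_exponent_le w h0 : lam < w ->
  (forall h, h0 < h -> attains 0 theta w h) -> False.
Proof.
move=> lw att; pose e := (w - lam) / (2 * w + 2).
have w0 : 0 < w by apply: lt_trans lw.
have w2 : 0 < 2 * w + 2 by lra.
have e0 : 0 < e by rewrite divr_gt0 //; lra.
have e1 : e * (2 * w + 2) = w - lam by rewrite divfK // gt_eqF.
have d0 : 0 < 1 - 2 * e by rewrite -(pmulr_rgt0 _ w0); have := lam0; lra.
have [k1 Hk1] := stage e0; have [k2 Hk2] := low_unbounded h0 d0.
pose D : R := (1 + n.+1)%:R; have D0 : 0 < D by rewrite ltr0n.
have D1 : 1 <= D by rewrite ler1n.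
have [k3 Hk3] := low_unbounded (ln (2 * D)) e0.
pose k := (k1 + k2 + k3)%N.
have [_ _ _ H] := Hk1 k (leq_trans (leq_addr _ _) (leq_addr _ _)).
have [_ lt_h] := Hk2 k (leq_trans (leq_addl _ _) (leq_addr _ _)).
have [_ lt_D] := Hk3 k (leq_addl _ _).
have [L [L1 L2 L3]] := att _ lt_h.
have := H _ _ (point_approx_mono L2 L3 (point_of_affine theta L1)).
apply/negP; rewrite -ltNge.
have S0 := high_gt0 R k.
have DD : D * expR (- (e * high R k)) < 1 / 2.
  rewrite expRN ltr_pdivrMr ?expR_gt0 // mul1r ltr_pdivlMl //.
  by rewrite -[ltLHS]lnK ?posrE ?mulr_gt0 // ltr_expR.
have eq1 : (lam + 2 * e) * high R k <= (w * (1 - 2 * e)) * high R k.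
  by rewrite ler_pM2r //; lra.
have t1 : D * (expR ((lam + e) * high R k) * expR (- (w * ((1 - 2 * e) * high R k)))) < 1 / 2.
  by apply: le_lt_trans DD; rewrite ler_pM2l // -expRD ler_expR; lra.
have t2 : expR ((1 - 2 * e) * high R k) * expR (- ((1 - e) * high R k)) < 1 / 2.
  apply: le_lt_trans DD; rewrite -expRD -[leLHS]mul1r ler_pM ?expR_ge0 //.
  by rewrite ler_expR; lra.
rewrite -/D; lra.
Qed.

End Main.

Lemma expansion_lin_indep (R : realType) n (tau : nat -> R) b theta A Y F :
  (1 < n)%N -> @expansion R n tau b theta A Y F -> one_lin_indep theta.
Proof.
move=> n_gt1 X a0 a a_eq0.
pose v : 'rV[rat]_(1 + n) := row_mx a0%:M (\row_i a i).
have [D [z [D0 zD]]] := int_multiple v.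
have zR : intmx R z = D%:~R *: map_mx ratr v.
  by rewrite /intmx -map_ratr_int zD map_mxZ /= ratr_int.
have z0 : z = 0.
  have scaleA := expansion_scale X.
  apply: (dot_int_eq0 n_gt1 scaleA.1 (is_scale_grow n_gt1 scaleA) (expansion_point X)
    (expansion_point_init X) (expansion_approx X)).
  rewrite -/(intmx R z) zR dotC dotZr /dot big_split_ord /= big_ord1.
  have vl : map_mx ratr v 0 (lshift n 0) = ratr a0 :> R.
    by rewrite mxE row_mxEl mxE eqxx mulr1n.
  have vr i : map_mx ratr v 0 (rshift 1 i) = ratr (a i) :> R.
    by rewrite mxE row_mxEr mxE.
  have -> : lshift n 0 = 0 :> 'I_(1 + n) by apply/val_inj.
  rewrite (_ : _ + _ = 0) ?mulr0 // -[RHS]a_eq0; congr (_ + _).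
    by rewrite homog0 mul1r -vl; congr (map_mx _ _ _ _); apply/val_inj.
  by apply: eq_bigr => i _; rewrite homogE vr mulrC.
have v0 : v = 0.
  by apply: (@scalerI _ _ D%:~R); rewrite ?intr_eq0 // -zD z0 map_mx0 scaler0.
split.
  have /rowP/(_ (lshift n 0)) := v0.
  by rewrite row_mxEl !mxE eqxx mulr1n.
by move=> i; have /rowP/(_ (rshift 1 i)) := v0; rewrite row_mxEr !mxE.
Qed.

(** Cantor's diagonal argument: [diag] is a bit sequence that disagrees with each [b] at the code of
    [f b]. *)
Lemma uncountable_range (T : Type) (f : (nat -> bool) -> T) (P : set T) :
  (forall b b', f b = f b' -> b = b') -> (forall b, P (f b)) -> ~ countable P.
Proof.
move=> f_inj Pf /countable_injP[g g_inj].
have gf_inj b b' : g (f b) = g (f b') -> b = b'.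
  by move=> e; apply: f_inj; apply: g_inj => //; rewrite in_setE.
pose diag m := `[< exists2 b, g (f b) = m & b m = false >].
have [eT|eF] := boolP (diag (g (f diag))).
  by have /asboolP[b /gf_inj ->] := eT; rewrite eT.
by move/negP: (eF); apply; apply/asboolP; exists diag => //; exact: negbTE.
Qed.

Lemma expansion_exponents (R : realType) n (lam vp : R) b (theta : 'rV[R]_n) A Y F
    (omega : \bar R) :
  (1 < n)%N -> 0 <= vp -> vp * n%:R <= 1 -> 1 <= vp + (n%:R - 1) * lam ->
  (n%:R - 1) * vp + lam <= 1 -> expansion (tau n lam vp) b theta A Y F ->
  (omega = +oo%E /\ vp = 0) \/ (omega = (vp^-1)%:E /\ 0 < vp) ->
  uniform_exponent n.-1 theta = omega /\ uniform_exponent 0 theta = lam%:E.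
Proof.
case: n theta Y F => // n theta Y F n_gt1 vp0 vpn lam_ge lam_le X omegaE.
have lam0 : 0 < lam := lam_gt0 n_gt1 vp0 vpn lam_ge.
split; apply/eqP; rewrite eq_le; apply/andP; split.
- case: omegaE => [[-> _]|[-> vp_gt0]]; first exact: leey.
  apply: exponent_le => w h0 lt_w.
  have w0 : 0 < w by apply: lt_trans lt_w; rewrite invr_gt0.
  apply: (form_exponent_le n_gt1 vp0 vpn lam_ge lam_le X) => //.
  by rewrite -ltr_pdivrMr // mul1r.
- apply: exponent_ge.
    by case: omegaE => [[-> _]|[-> vp_gt0]]; rewrite ?ltry // lte_fin invr_gt0.
  move=> w w0 w_lt; apply: (form_exponent_ge n_gt1 vp0 vpn lam_ge lam_le X) => //.
  case: omegaE w_lt => [[_ ->]|[-> vp_gt0]]; first by rewrite mulr0.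
  by rewrite lte_fin -[vp^-1]mul1r ltr_pdivlMr.
- apply: exponent_le => w h0 lt_w.
  exact: (point_exponent_le n_gt1 vp0 vpn lam_ge lam_le X).
- apply: exponent_ge; first by rewrite lte_fin.
  move=> w w0; rewrite lte_fin => w_lt.
  exact: (point_exponent_ge n_gt1 vp0 vpn lam_ge lam_le X).
Qed.

Theorem theorem3 (R : realType) (n : nat) (hn : (2 <= n)%N)
    (omega : \bar R) (homega : (n%:R%:E <= omega)%E)
    (lambda : R) (hlambda : lambda_interval n omega lambda) :
  ~ countable [set theta : 'rV[R]_n |
      [/\ one_lin_indep theta,
          uniform_exponent n.-1 theta = omega &
          uniform_exponent 0 theta = lambda%:E]].
Proof.
have n2 : 2 <= n%:R :> R by rewrite ler_nat.
(* The smallest weight is [1 / omega], read as 0 for an infinite [omega]; the interval for [lambda]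
   then becomes the two weight inequalities. *)
have [vp [vp0 vpn lam_ge lam_le omegaE]] : exists vp : R, [/\ 0 <= vp, vp * n%:R <= 1,
    1 <= vp + (n%:R - 1) * lambda, (n%:R - 1) * vp + lambda <= 1 &
    (omega = +oo%E /\ vp = 0) \/ (omega = (vp^-1)%:E /\ 0 < vp)].
  case: omega homega hlambda => [r|_|//] /=; last first.
    move=> /andP[]; rewrite ler_pdivrMr; last by lra.
    by move=> h1 h2; exists 0; split; [lra|lra|lra|lra|left].
  rewrite lee_fin => le_nr /andP[]; have r0 : 0 < r by lra.
  rewrite ler_pdivrMr ?mulr_gt0 //; last by lra.
  rewrite ler_pdivlMr // => h1 h2; exists r^-1; split.
  - by rewrite invr_ge0 ltW.
  - by rewrite mulrC ler_pdivrMr // mul1r.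
  - by rewrite -(ler_pM2r r0) mulrDl mulVf ?gt_eqF //; lra.
  - by rewrite -(ler_pM2r r0) mulrDl -mulrA mulVf ?gt_eqF //; lra.
  - by right; rewrite invrK invr_gt0.
have /choice[f Hf] : forall b, exists theta, exists A Y F,
    expansion (tau n lambda vp) b theta A Y F := expansion_exists _ hn.
apply: (uncountable_range (f := f)).
  move=> b b' e; have [A [Y [F X]]] := Hf b; have [A' [Y' [F' X']]] := Hf b'.
  by rewrite -e in X'; exact: (expansion_inj hn X X').
move=> b; have [A [Y [F X]]] := Hf b.
have [e1 e2] := expansion_exponents hn vp0 vpn lam_ge lam_le X omegaE.
by split=> //; exact: expansion_lin_indep hn X.
Qed.
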